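(* Let $\mathsf{K}^\ast\in\mathcal{C}_{n,0}$ be a stationary point of $J_{\mathtt{LQG},n}$, i.e., $\nabla J_{\mathtt{LQG},n}(\mathsf{K}^\ast)=0$. If $\mathsf{K}^\ast$ is a non-degenerate policy for LQG, then it is a global minimum of $J_{\mathtt{LQG},n}$ over $\mathcal{C}_{n,0}$.
   Context: Plant data: integers $n,m,p\ge 1$, real matrices $A\in\mathbb{R}^{n\times n}$, $B\in\mathbb{R}^{n\times m}$, $C\in\mathbb{R}^{p\times n}$, and symmetric weights $Q\succeq 0$, $W\succeq 0$ ($n\times n$), $R\succ 0$ ($m\times m$), $V\succ 0$ ($p\times p$); $M^{1/2}$ is the symmetric positive semidefinite square root. Standing assumptions: $(A,B)$ and $(A,W^{1/2})$ are controllable, $(C,A)$ and $(Q^{1/2},A)$ are observable. A square matrix is stable if all its eigenvalues have strictly negative real parts. A strictly proper dynamic policy of order $n$ is a matrix $\mathsf{K}=\begin{bmatrix}0 & C_{\mathsf K}\\ B_{\mathsf K} & A_{\mathsf K}\end{bmatrix}$ with $A_{\mathsf K}\in\mathbb{R}^{n\times n}$, $B_{\mathsf K}\in\mathbb{R}^{n\times p}$, $C_{\mathsf K}\in\mathbb{R}^{m\times n}$ and zero $m\times p$ upper-left block; $\mathcal{V}_n$ is the vector space of all such matrices. Define $$A_{\mathrm{cl}}(\mathsf K)=\begin{bmatrix}A & BC_{\mathsf K}\\ B_{\mathsf K}C & A_{\mathsf K}\end{bmatrix},\quad B_{\mathrm{cl}}(\mathsf K)=\begin{bmatrix}W^{1/2}&0\\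 0&B_{\mathsf K}V^{1/2}\end{bmatrix},\quad C_{\mathrm{cl}}(\mathsf K)=\begin{bmatrix}Q^{1/2}&0\\ 0&R^{1/2}C_{\mathsf K}\end{bmatrix}.$$ $\mathcal{C}_{n,0}=\{\mathsf K\in\mathcal{V}_n: A_{\mathrm{cl}}(\mathsf K)\text{ is stable}\}$, an open subset of $\mathcal{V}_n$. The LQG cost is $J_{\mathtt{LQG},n}(\mathsf K)=\|\mathbf{T}(\mathsf K,\cdot)\|_{\mathcal{H}_2}$ for $\mathsf K\in\mathcal{C}_{n,0}$, where $\mathbf{T}(\mathsf K,s)=C_{\mathrm{cl}}(\mathsf K)(sI-A_{\mathrm{cl}}(\mathsf K))^{-1}B_{\mathrm{cl}}(\mathsf K)$ and $\|\mathbf{T}\|_{\mathcal{H}_2}^2=\frac{1}{2\pi}\int_{-\infty}^{\infty}\operatorname{tr}(\mathbf{T}(j\omega)^{\mathsf H}\mathbf{T}(j\omega))\,d\omega$. It is real analytic on $\mathcal{C}_{n,0}$; $\nabla J_{\mathtt{LQG},n}$ is the gradient with respect to $(A_{\mathsf K},B_{\mathsf K},C_{\mathsf K})$. A policy $\mathsf K\in\mathcal{C}_{n,0}$ is non-degenerate for LQG if, with $\gamma=J_{\mathtt{LQG},n}(\mathsf K)$, there exist a symmetric positive definite $P=\begin{bmatrix}P_{11}&P_{12}\\ P_{12}^{\mathsf T}&P_{22}\end{bmatrix}\in\mathbb{R}^{2n\times 2n}$ (with $n\times n$ blocks) whose block $P_{12}$ is invertible, and a symmetric $\Gamma$, such that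 $$\begin{bmatrix}A_{\mathrm{cl}}(\mathsf K)^{\mathsf T}P+PA_{\mathrm{cl}}(\mathsf K)&PB_{\mathrm{cl}}(\mathsf K)\\ B_{\mathrm{cl}}(\mathsf K)^{\mathsf T}P&-\gamma I\end{bmatrix}\preceq0,\quad\begin{bmatrix}P&C_{\mathrm{cl}}(\mathsf K)^{\mathsf T}\\ C_{\mathrm{cl}}(\mathsf K)&\Gamma\end{bmatrix}\succeq0,\quad\operatorname{tr}(\Gamma)\le\gamma.$$ *)

(* Defs.v *)
From HB Require Import structures.
From mathcomp Require Import all_boot all_order all_algebra.
From mathcomp Require Import all_classical all_reals all_analysis.
From mathcomp Require Import complex.

Set Implicit Arguments.
Unset Strict Implicit.
Unset Printing Implicit Defensive.

Import Order.TTheory GRing.Theory Num.Theory.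
Import numFieldNormedType.Exports.

Local Open Scope classical_set_scope.
Local Open Scope ring_scope.
Local Open Scope complex_scope.

Section Matrices.
Context {R : realType}.

Definition psd (k : nat) (M : 'M[R]_k) : Prop :=
  M^T = M /\ forall x : 'cV[R]_k, 0 <= (x^T *m M *m x) 0 0.

Definition posdef (k : nat) (M : 'M[R]_k) : Prop :=
  M^T = M /\ forall x : 'cV[R]_k, x != 0 -> 0 < (x^T *m M *m x) 0 0.

Definition nsd (k : nat) (M : 'M[R]_k) : Prop := psd (- M).

(* The symmetric positive semidefinite square root; it exists and is unique
   exactly when [M] is positive semidefinite, and is the junk value 0 otherwise. *)
Definition sqrtmx (k : nat) (M : 'M[R]_k) : 'M[R]_k :=
  xget 0 [set S : 'M[R]_k | psd S /\ S *m S = M].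

Definition mxC (k l : nat) (M : 'M[R]_(k, l)) : 'M[R[i]]_(k, l) :=
  map_mx (fun x : R => x%:C) M.

Definition stable (k : nat) (M : 'M[R]_k) : Prop :=
  forall z : R[i], eigenvalue (mxC M) z -> complex.Re z < 0.

(* Kalman rank conditions: [B, AB, ..., A^(n-1) B] has full row rank and
   [C; CA; ...; C A^(n-1)] has full column rank. *)
Definition controllable (n m : nat) (A : 'M[R]_n) (B : 'M[R]_(n, m)) : Prop :=
  \rank (\mxrow_(i < n) (A ^+ i *m B)) = n.

Definition observable (n p : nat) (C : 'M[R]_(p, n)) (A : 'M[R]_n) : Prop :=
  \rank (\mxcol_(i < n) (C *m A ^+ i)) = n.

(* The trace below is real and nonnegative, so taking its real part only
   changes its type. The integral is finite for C (sI - A)^-1 B with A stable;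
   a divergent integral would be read as 0. *)
Definition h2norm (k l : nat) (T : R[i] -> 'M[R[i]]_(k, l)) : R :=
  Num.sqrt ((2 * pi)^-1 *
    \int[@lebesgue_measure R]_(w in [set: R])
      complex.Re (\tr ((map_mx (@conjc R) (T (0 +i* w)))^T *m T (0 +i* w)))).

End Matrices.

Section Policies.
Context {R : realType} {n m p : nat}.

(* The strictly proper policy [0, CK; BK, AK] is represented by its free blocks
   (AK, BK, CK), i.e. by its coordinates in the vector space of such matrices. *)
Definition policy : Type := ('M[R]_n * 'M[R]_(n, p) * 'M[R]_(m, n))%type.

Definition polA (K : policy) : 'M[R]_n := K.1.1.
Definition polB (K : policy) : 'M[R]_(n, p) := K.1.2.
Definition polC (K : policy) : 'M[R]_(m, n) := K.2.

Definition gradient (f : policy -> R)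
    (K : policy) : policy :=
  (\matrix_(i, j) 'D_((delta_mx i j, 0, 0)) f K,
   \matrix_(i, j) 'D_((0, delta_mx i j, 0)) f K,
   \matrix_(i, j) 'D_((0, 0, delta_mx i j)) f K).

(* Library derivatives are total, so the existence of the gradient has to be
   stated separately. *)
Definition stationary (f : policy -> R)
    (K : policy) : Prop :=
  differentiable f K /\ gradient f K = (0, 0, 0).

Variables (A : 'M[R]_n) (B : 'M[R]_(n, m)) (C : 'M[R]_(p, n)).
Variables (Q W : 'M[R]_n) (Rw : 'M[R]_m) (V : 'M[R]_p).

Definition Acl (K : policy) : 'M[R]_(n + n) :=
  block_mx A (B *m polC K) (polB K *m C) (polA K).

Definition Bcl (K : policy) : 'M[R]_(n + n, n + p) :=
  block_mx (sqrtmx W) 0 0 (polB K *m sqrtmx V).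

Definition Ccl (K : policy) : 'M[R]_(n + m, n + n) :=
  block_mx (sqrtmx Q) 0 0 (sqrtmx Rw *m polC K).

Definition stabilizing : set policy := [set K | stable (Acl K)].

Definition Tcl (K : policy) (s : R[i]) : 'M[R[i]]_(n + m, n + p) :=
  mxC (Ccl K) *m invmx (s%:M - mxC (Acl K)) *m mxC (Bcl K).

(* Meaningful on [stabilizing] only. *)
Definition JLQG (K : policy) : R := h2norm (Tcl K).

Definition lqg_nondegenerate (K : policy) : Prop :=
  exists (P : 'M[R]_(n + n)) (G : 'M[R]_(n + m)),
    [/\ posdef P, ursubmx P \in unitmx & G^T = G] /\
    [/\ nsd (block_mx ((Acl K)^T *m P + P *m Acl K) (P *m Bcl K)
                      ((Bcl K)^T *m P) (- (JLQG K)%:M)),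
        psd (block_mx P (Ccl K)^T (Ccl K) G)
      & \tr G <= JLQG K].

End Policies.

Arguments policy : clear implicits.

(* Main.v *)
From HB Require Import structures.
Require Import Defs.
From mathcomp Require Import all_boot all_order all_algebra.
From mathcomp Require Import all_classical all_reals all_analysis.
From mathcomp Require Import measurable_realfun complex ring lra.

(** Why the theorem holds.

    The cost admits a convex lifting. For a stable closed loop and g > 0, the
    bound J(K) <= g follows from three conditions on a pair (P, G) with P
    positive definite: the two matrix inequalities in the definition of
    non-degeneracy and tr G <= g ([h2_lmi_sound]); conversely such a pair exists
    for every g > J(K) ([h2_lmi_complete]). These inequalities are bilinear in
    (K, P), but a congruence built from the blocks of P and of its inverse turns
    them into inequalities that are affine in new variables (X, Y, Ah, Bh, Ch),
    in g and in G ([lift_certificate], [lifted_lmi_mix]). From the new variables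
    one can go back to a policy as soon as the block M of the inverse of P is
    invertible, and invertibility of the block P12 at the starting point is
    exactly what is required for that ([decode_certificate], [decode_encode]).

    Suppose that a stabilizing K' had J(K') < J(Ks), and pick g1 strictly between
    the two costs. The certificate of Ks at level J(Ks), given by
    non-degeneracy, and a certificate of K' at level g1 are joined by a segment
    in the lifted variables. Decoding that segment with the block M frozen at
    its value for Ks gives a curve K(t) of policies with K(0) = Ks, which is
    differentiable at 0 ([certified_path]). Only the starting point needs an
    invertible block: for t < 1 the lifted positivity condition is strict
    because it is strict at t = 0. For small t > 0 the loop is still stable
    ([stable_near]), so J(K(t)) <= (1 - t) J(Ks) + t g1, and the slope of J
    along the curve is at most g1 - J(Ks) < 0. This contradicts stationarity
    ([stationary_no_descent]).

    What remains is to express the frequency domain integral by a Lyapunov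
    equation. If A L + L A^T = - S and H(w) = (iw - A)^-1, then
    H S H^* = L H^* + H L, so everything reduces to the principal value over the
    imaginary axis of the resolvent, which is pi times the identity
    ([mx_pv_resolvent]). By the theorem of Cayley and Hamilton the resolvent is a
    combination of products of simple poles 1/(iw - z), z running through the
    eigenvalues. A single pole has an elementary primitive and contributes pi; a
    product of two or more contributes 0, by partial fractions down to powers of
    one pole ([cplx_pv_prod_poles]). The same identity shows that the Lyapunov
    equation is solvable, and that its solution is positive semidefinite when S
    is. *)

Set Implicit Arguments.
Unset Strict Implicit.
Unset Printing Implicit Defensive.

Import Order.TTheory GRing.Theory Num.Theory.
Import numFieldNormedType.Exports.
Local Open Scope classical_set_scope.
Local Open Scope ring_scope.

(** * Principal values through primitives *)

Section PrincipalValue.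
Variable R : realType.
Implicit Types (f g : R -> R) (l k : R).

(** The symmetric improper integral of [f] is [l]. Stating it through a primitive
    makes closure under linear combinations immediate, and integrals only enter
    in [integral_real_pv]. The limit is symmetric because the primitive of a
    single pole has a logarithmic part, which diverges at each end. *)
Definition real_pv f l : Prop := continuous f /\
  exists F : R -> R, (forall w : R, is_derive w (1 : R) F (f w)) /\
    (F a - F (- a) @[a --> +oo] --> l).

Lemma cvg_ext f g l (F : set_system R) :
  f =1 g -> f x @[x --> F] --> l -> g x @[x --> F] --> l.
Proof. by move=> /funext ->. Qed.

Lemma eq_real_pv f g l : f =1 g -> real_pv f l -> real_pv g l.
Proof. by move=> /funext ->. Qed.

Lemma real_pv0 : real_pv (fun=> 0) 0.
Proof.
split; first exact: cst_continuous.
exists (fun=> 0); split; first by move=> w; exact: is_derive_cst.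
by rewrite subrr; exact: cvg_cst.
Qed.

Lemma real_pv_lin (a b : R) f g l k : real_pv f l -> real_pv g k ->
  real_pv (fun w => a * f w + b * g w) (a * l + b * k).
Proof.
move=> [cf [F [dF lF]]] [cg [G [dG lG]]]; split.
  move=> w; apply: cvgD; apply: cvgM;
    [exact: cvg_cst|exact: cf|exact: cvg_cst|exact: cg].
exists (fun c => a * F c + b * G c); split.
  move=> w; have dFw := dF w; have dGw := dG w.
  exact: (is_deriveD (is_deriveZ a dFw) (is_deriveZ b dGw)).
rewrite (_ : (fun _ => _) = (fun c => a * (F c - F (- c)) + b * (G c - G (- c)))).
  by apply: cvgD; apply: cvgM => //; exact: cvg_cst.
by apply/funext => c; ring.
Qed.

(** The primitive of a nonnegative function is nondecreasing. Applied to the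
    difference of two functions, this also gives uniqueness of principal values. *)
Lemma real_pv_ge0 f l : (forall w, 0 <= f w) -> real_pv f l -> 0 <= l.
Proof.
move=> f0 [_ [F [dF lF]]].
have F_nd (x y : R) : x <= y -> F x <= F y.
  rewrite le_eqVlt => /orP[/eqP -> //|xy].
  have [] := MVT xy (fun x _ => dF x).
    by apply: derivable_within_continuous => z _; exact: ex_derive.
  by move=> z _ /eqP; rewrite subr_eq => /eqP ->; rewrite lerDr mulr_ge0// subr_ge0 ltW.
apply: cvgr_to_ge lF _.
by near=> a; rewrite subr_ge0; apply: F_nd; near: a; exists 0; split=> // a; lra.
Unshelve. all: by end_near. Qed.

(** For a nonnegative function the symmetric limit is the Lebesgue integral, by
    monotone convergence along the intervals -n <= w <= n. *)
Lemma integral_real_pv f l : (forall w, 0 <= f w) -> real_pv f l ->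
  \int[@lebesgue_measure R]_(w in [set: R]) f w = l.
Proof.
move=> f0 [cf [F [dF lF]]].
have mf : @measurable_fun _ _ (measurableTypeR R) (measurableTypeR R) setT f.
  exact: continuous_measurable_fun.
pose D (i : nat) := `[- i.+1%:R, i.+1%:R]%classic : set R.
have := @ge0_nondecreasing_set_cvg_integral _ (measurableTypeR R) R D
  (fun x => (f x)%:E) lebesgue_measure.
have -> : \bigcup_i D i = [set: R].
  apply/seteqP; split => // x _.
  exists (Num.truncn `|x|) => //; rewrite /D /= in_itv /= -ler_norml.
  by rewrite ltW // truncnS_gt.
have -> : (fun i => \int[lebesgue_measure]_(x in D i) (f x)%:E)%E =
          (fun i => (F i.+1%:R - F (- i.+1%:R))%:E).
  apply/funext => i; rewrite EFinB; apply: continuous_FTC2.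
  - by rewrite -subr_gt0 opprK -natrD ltr0n.
  - by apply: continuous_subspaceT.
  - split.
    + by move=> x _; exact: ex_derive.
    + apply: cvg_at_right_filter; apply: differentiable_continuous.
      by apply/derivable1_diffP; exact: ex_derive.
    + apply: cvg_at_left_filter; apply: differentiable_continuous.
      by apply/derivable1_diffP; exact: ex_derive.
  - by move=> x _; rewrite derive1E; exact: derive_val.
have lF' : (F i.+1%:R - F (- i.+1%:R))%:E @[i --> \oo] --> l%:E.
  apply: cvg_EFin; first by near=> i.
  have : (i.+1%:R : R) @[i --> \oo] --> +oo.
    by have := @cvgr_idn R; rewrite -cvg_shiftS.
  by move=> h; exact: (cvg_comp _ _ h lF).
move=> H.
have {}H : (F i.+1%:R - F (- i.+1%:R))%:E @[i --> \oo] -->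
    (\int[lebesgue_measure]_x (f x)%:E)%E.
  apply: H => //.
  - apply/nondecreasing_seqP => i; rewrite subsetEset => x.
    rewrite /D /= !in_itv /= => /andP[h1 h2].
    by rewrite (le_trans _ h1) ?(le_trans h2) //= ?lerN2 ler_nat //.
  - by move=> i; exact: measurable_itv.
  - move=> i; apply/(@measurable_EFinP _ (measurableTypeR R) R (D i) f).
    exact: measurable_funTS.
  - by move=> i x _; rewrite lee_fin.
by rewrite /Rintegral (cvg_unique _ H lF').
Unshelve. all: by end_near. Qed.

End PrincipalValue.

Section ComplexPrincipalValue.
Variable R : realType.
Local Open Scope complex_scope.
Implicit Types (f g : R -> R[i]) (l k a b z : R[i]).

Definition cplx_pv f l : Prop :=
  real_pv (fun w => complex.Re (f w)) (complex.Re l) /\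
  real_pv (fun w => complex.Im (f w)) (complex.Im l).

Lemma eq_cplx_pv f g l : f =1 g -> cplx_pv f l -> cplx_pv g l.
Proof. by move=> /funext ->. Qed.

Lemma cplx_pv0 : cplx_pv (fun=> 0) 0.
Proof. by split; exact: real_pv0. Qed.

Lemma cplx_pv_lin a b f g l k : cplx_pv f l -> cplx_pv g k ->
  cplx_pv (fun w => a * f w + b * g w) (a * l + b * k).
Proof.
move=> [fr fi] [gr gi]; split.
- have := real_pv_lin 1 1 (real_pv_lin (complex.Re a) (- complex.Im a) fr fi)
                      (real_pv_lin (complex.Re b) (- complex.Im b) gr gi).
  rewrite (_ : (1 * _ + _) = complex.Re (a * l + b * k)).
    apply: eq_real_pv => w; case: a b (f w) (g w) => [? ?] [? ?] [? ?] [? ?] /=; ring.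
  by case: a b l k {fr fi gr gi} => [? ?] [? ?] [? ?] [? ?] /=; ring.
- have := real_pv_lin 1 1 (real_pv_lin (complex.Im a) (complex.Re a) fr fi)
                      (real_pv_lin (complex.Im b) (complex.Re b) gr gi).
  rewrite (_ : (1 * _ + _) = complex.Im (a * l + b * k)).
    apply: eq_real_pv => w; case: a b (f w) (g w) => [? ?] [? ?] [? ?] [? ?] /=; ring.
  by case: a b l k {fr fi gr gi} => [? ?] [? ?] [? ?] [? ?] /=; ring.
Qed.

Lemma cplx_pvD f g l k : cplx_pv f l -> cplx_pv g k ->
  cplx_pv (fun w => f w + g w) (l + k).
Proof.
move=> fl gk; have := cplx_pv_lin 1 1 fl gk; rewrite !mul1r.
by apply: eq_cplx_pv => w; rewrite !mul1r.
Qed.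

Lemma cplx_pvZ a f l : cplx_pv f l -> cplx_pv (fun w => a * f w) (a * l).
Proof.
move=> fl; have := cplx_pv_lin a 0 fl cplx_pv0; rewrite mul0r addr0.
by apply: eq_cplx_pv => w; rewrite ?mul0r addr0.
Qed.

Lemma cplx_pv_sum (I : Type) (r : seq I) (F : I -> R -> R[i]) (L : I -> R[i]) :
  (forall i, cplx_pv (F i) (L i)) ->
  cplx_pv (fun w => \sum_(i <- r) F i w) (\sum_(i <- r) L i).
Proof.
move=> FL; elim: r => [|i r IH].
  by rewrite big_nil; apply: eq_cplx_pv cplx_pv0 => w; rewrite big_nil.
rewrite big_cons; apply: eq_cplx_pv (cplx_pvD (FL i) IH) => w.
by rewrite big_cons.
Qed.

Lemma cplx_pv_conj f l : cplx_pv f l -> cplx_pv (fun w => (f w)^*) l^*.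
Proof.
move=> [fr fi]; split.
  by apply: eq_real_pv (_ : real_pv _ _); [|rewrite (_ : complex.Re l^* = complex.Re l);
    [exact: fr|by case: l {fr fi}]] => w; case: (f w).
have := real_pv_lin (-1) 0 fi (real_pv0 R).
rewrite (_ : _ + _ = complex.Im l^*); last by case: l {fr fi} => ? ? /=; ring.
by apply: eq_real_pv => w; case: (f w) => ? ? /=; ring.
Qed.

Lemma real_pv_unique (f : R -> R) (l k : R) : real_pv f l -> real_pv f k -> l = k.
Proof.
move=> fl fk.
have h (x y : R) : real_pv f x -> real_pv f y -> y <= x.
  move=> fx fy; rewrite -subr_ge0.
  have := real_pv_lin 1 (-1) fx fy; rewrite mul1r mulN1r => /real_pv_ge0; apply=> w.
  by rewrite mul1r mulN1r subrr.
by apply/eqP; rewrite eq_le !h.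
Qed.

Lemma cplx_pv_unique f l k : cplx_pv f l -> cplx_pv f k -> l = k.
Proof.
case: l k => [a b] [c d] [fr fi] [fr' fi'].
by have /= -> := real_pv_unique fr fr'; have /= -> := real_pv_unique fi fi'.
Qed.

Definition cplx_deriv f g : Prop := forall w : R,
  is_derive w (1 : R) (fun x => complex.Re (f x)) (complex.Re (g w)) /\
  is_derive w (1 : R) (fun x => complex.Im (f x)) (complex.Im (g w)).

Lemma eq_cplx_deriv f g df dg : f =1 g -> df =1 dg -> cplx_deriv f df ->
  cplx_deriv g dg.
Proof. by move=> /funext -> /funext ->. Qed.

Lemma cplx_derivZ a f df : cplx_deriv f df ->
  cplx_deriv (fun w => a * f w) (fun w => a * df w).
Proof.
move=> D w; have [Dr Di] := D w; case: a => a b; split.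
- apply: is_derive_eq.
    rewrite (_ : (fun _ => _) = (fun x => a * complex.Re (f x) - b * complex.Im (f x))).
      exact: (is_deriveB (is_deriveZ a Dr) (is_deriveZ b Di)).
    by apply/funext => x; case: (f x).
  by case: (df w).
- apply: is_derive_eq.
    rewrite (_ : (fun _ => _) = (fun x => a * complex.Im (f x) + b * complex.Re (f x))).
      exact: (is_deriveD (is_deriveZ a Di) (is_deriveZ b Dr)).
    by apply/funext => x; case: (f x).
  by case: (df w).
Qed.

Lemma cplx_derivM f g df dg : cplx_deriv f df -> cplx_deriv g dg ->
  cplx_deriv (fun w => f w * g w) (fun w => df w * g w + f w * dg w).
Proof.
move=> Df Dg w; have [Dfr Dfi] := Df w; have [Dgr Dgi] := Dg w; split.
- apply: is_derive_eq.
    rewrite (_ : (fun _ => _) = (fun x => complex.Re (f x) * complex.Re (g x) -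
        complex.Im (f x) * complex.Im (g x))).
      exact: (is_deriveB (is_deriveM Dfr Dgr) (is_deriveM Dfi Dgi)).
    by apply/funext => x; case: (f x) (g x) => ? ? [].
  case: (f w) (g w) (df w) (dg w) => ? ? [? ?] [? ?] [? ?] /=.
  by rewrite /GRing.scale /=; ring.
- apply: is_derive_eq.
    rewrite (_ : (fun _ => _) = (fun x => complex.Re (f x) * complex.Im (g x) +
        complex.Im (f x) * complex.Re (g x))).
      exact: (is_deriveD (is_deriveM Dfr Dgi) (is_deriveM Dfi Dgr)).
    by apply/funext => x; case: (f x) (g x) => ? ? [].
  case: (f w) (g w) (df w) (dg w) => ? ? [? ?] [? ?] [? ?] /=.
  by rewrite /GRing.scale /=; ring.
Qed.

Lemma cplx_derivX f df n : cplx_deriv f df ->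
  cplx_deriv (fun w => f w ^+ n.+1) (fun w => n.+1%:R * f w ^+ n * df w).
Proof.
move=> D; elim: n => [|n IH].
  apply: eq_cplx_deriv D => w; first by rewrite expr1.
  by rewrite expr0 mulr1 mul1r.
apply: eq_cplx_deriv (cplx_derivM D IH) => w; first by rewrite [RHS]exprS.
by rewrite !exprS -[in RHS]natr1; ring.
Qed.

Definition cplx_cvg (f : R -> R[i]) (F : set_system R) l : Prop :=
  (complex.Re (f x) @[x --> F] --> complex.Re l) /\
  (complex.Im (f x) @[x --> F] --> complex.Im l).

Lemma cplx_pv_primitive (F : R -> R[i]) f l :
  (forall w, {for w, continuous (fun w => complex.Re (f w))}) ->
  (forall w, {for w, continuous (fun w => complex.Im (f w))}) ->
  cplx_deriv F f -> cplx_cvg (fun t => F t - F (- t)) +oo l -> cplx_pv f l.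
Proof.
move=> cr ci DF [lr li]; split; split => //.
- exists (fun x => complex.Re (F x)); split; first by move=> w; have [] := DF w.
  by apply: cvg_ext lr => x; case: (F x) (F (- x)) => ? ? [].
- exists (fun x => complex.Im (F x)); split; first by move=> w; have [] := DF w.
  by apply: cvg_ext li => x; case: (F x) (F (- x)) => ? ? [].
Unshelve. all: by end_near. Qed.

Lemma cplx_deriv_continuous f df : cplx_deriv f df -> forall w,
  {for w, continuous (fun w => complex.Re (f w))} /\
  {for w, continuous (fun w => complex.Im (f w))}.
Proof.
move=> D w; have [Dr Di] := D w; split.
- by apply: differentiable_continuous; apply/derivable1_diffP; exact: ex_derive.
- by apply: differentiable_continuous; apply/derivable1_diffP; exact: ex_derive.
Qed.

End ComplexPrincipalValue.

(** * Integrals of products of poles along the imaginary axis *)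

Section Poles.
Variable R : realType.
Local Open Scope complex_scope.
Implicit Types (z : R[i]) (w : R).

Lemma is_derive_conv (f : R -> R) (w d e : R) :
  is_derive w (1 : R) f d -> d = e -> is_derive w (1 : R) f e.
Proof. by move=> + <-. Qed.

Definition pole z w : R[i] := (0 +i* w - z)^-1.

Lemma poleRe z w : complex.Re (pole z w) =
  - complex.Re z * (complex.Re z ^+ 2 + (w - complex.Im z) ^+ 2)^-1.
Proof. by case: z => x y; rewrite /pole /= sub0r sqrrN. Qed.

Lemma poleIm z w : complex.Im (pole z w) =
  - ((w - complex.Im z) * (complex.Re z ^+ 2 + (w - complex.Im z) ^+ 2)^-1).
Proof. by case: z => x y; rewrite /pole /= sub0r sqrrN. Qed.

Section OnePole.
Variables (x y : R).
Hypothesis x_lt0 : x < 0.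
Let z := x +i* y.
Let den w : R := x ^+ 2 + (w - y) ^+ 2.

Let den_gt0 w : 0 < den w.
Proof. by rewrite ltr_pwDl ?sqr_ge0// exprn_even_gt0 //= lt_eqF. Qed.

Let den_neq0 w : den w != 0. Proof. by rewrite gt_eqF. Qed.

Let is_derive_sub w : is_derive w (1 : R) (fun v => v - y) (1 : R).
Proof.
have h := is_deriveB (is_derive_id w (1 : R)) (is_derive_cst y w (1 : R)).
by apply: is_derive_conv h _; rewrite subr0.
Qed.

Let is_derive_den w : is_derive w (1 : R) den (2 * (w - y)).
Proof.
have h := is_deriveD (is_derive_cst (x ^+ 2) w (1:R))
  (is_deriveM (is_derive_sub w) (is_derive_sub w)).
by apply: is_derive_conv h _; rewrite /GRing.scale /=; ring.
Qed.

Let is_derive_denV w :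
  is_derive w (1 : R) (fun v => (den v)^-1) (- (den w) ^- 2 * (2 * (w - y))).
Proof. exact: is_deriveV (den_neq0 w) (is_derive_den w). Qed.

Lemma cplx_deriv_pole1 : cplx_deriv (pole z) (fun w => - 'i * pole z w ^+ 2).
Proof.
move=> w; split.
- rewrite (_ : (fun _ => _) = (fun w => - x * (den w)^-1)); last first.
    by apply/funext => v; rewrite poleRe.
  apply: (is_derive_conv (is_deriveZ (- x) (is_derive_denV w))).
  have -> : complex.Re (- 'i * pole z w ^+ 2) =
            2 * complex.Re (pole z w) * complex.Im (pole z w).
    by rewrite expr2; case: (pole z w) => a b /=; ring.
  by rewrite poleRe poleIm /= -/(den w) /GRing.scale /=; field.
- rewrite (_ : (fun _ => _) = (fun w => - ((w - y) * (den w)^-1))); last first.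
    by apply/funext => v; rewrite poleIm.
  apply: (is_derive_conv (is_deriveN (is_deriveM (is_derive_sub w) (is_derive_denV w)))).
  have -> : complex.Im (- 'i * pole z w ^+ 2) =
            complex.Im (pole z w) ^+ 2 - complex.Re (pole z w) ^+ 2.
    by rewrite expr2; case: (pole z w) => a b /=; ring.
  rewrite poleRe poleIm /= -/(den w) /GRing.scale /=.

  apply: (mulfI (den_neq0 w)); apply: (mulfI (den_neq0 w)).
  transitivity (2 * (w - y) ^+ 2 - den w); first by field.
  transitivity ((w - y) ^+ 2 - x ^+ 2); first by rewrite /den; ring.
  by field.
Qed.

Let cvgy_sub : (w - y) @[w --> +oo] --> +oo.
Proof.
apply/cvgryPge => A; near=> w; rewrite lerBrDr; near: w.
by apply: nbhs_pinfty_ge; rewrite num_real.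
Unshelve. all: by end_near. Qed.

Let cvgy_div_den : ((w - y) * (den w)^-1) @[w --> +oo] --> (0 : R).
Proof.
apply: (@squeeze_cvgr _ _ _ _ (cst 0) (fun w => (w - y)^-1)).
- near=> w; have wy : 0 < w - y.
    by rewrite subr_gt0; near: w; apply: nbhs_pinfty_gt; rewrite num_real.
  apply/andP; split; first by rewrite mulr_ge0 ?invr_ge0 // ltW.
  rewrite ler_pdivrMr // mulrC ler_pdivlMr // -expr2.
  by rewrite /den lerDr sqr_ge0.
- exact: cvg_cst.
- apply: (gtr0_cvgV0 _).2 cvgy_sub.
  near=> w; rewrite subr_gt0; near: w.
  by apply: nbhs_pinfty_gt; rewrite num_real.
Unshelve. all: by end_near. Qed.

Let cvgy_denV : (den w)^-1 @[w --> +oo] --> (0 : R).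
Proof.
apply: (gtr0_cvgV0 _).2.
  by near=> w.
apply/cvgryPge => A; near=> w; have wy : `|A| + 1 <= w - y.
  by near: w; move/cvgryPge : cvgy_sub => /(_ (`|A| + 1)).
rewrite /den; apply: (le_trans (ler_norm A)).
have := normr_ge0 A; have := sqr_ge0 x; nra.
Unshelve. all: by end_near. Qed.

Lemma cplx_cvgy_pole1 : cplx_cvg (pole z) +oo 0.
Proof.
split.
- rewrite (_ : (fun _ => _) = (fun w => - x * (den w)^-1)); last first.
    by apply/funext => v; rewrite poleRe.
  rewrite /= -(mulr0 (- x)).
  by apply: cvgM; [exact: cvg_cst|exact: cvgy_denV].
- rewrite (_ : (fun _ => _) = (fun w => - ((w - y) * (den w)^-1))); last first.
    by apply/funext => v; rewrite poleIm.
  rewrite /= -oppr0.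
  by apply: cvgN; exact: cvgy_div_den.
Qed.

Let cvgy_scaled_sub (c : R) : ((w - c) / - x) @[w --> +oo] --> +oo.
Proof.
apply/cvgryPge => A; near=> w; rewrite ler_pdivlMr ?oppr_gt0 // lerBrDr.
by near: w; apply: nbhs_pinfty_ge; rewrite num_real.
Unshelve. all: by end_near. Qed.

Let cvgy_den_ratio : (den (- w) / den w) @[w --> +oo] --> (1 : R).
Proof.
(* den (- w) = den w + 4 y w, and w = (w - y) + y. *)
have h : (1 + (4 * y) * ((w - y) * (den w)^-1 + y * (den w)^-1)) @[w --> +oo]
    --> 1 + (4 * y) * (0 + y * 0).
  apply: cvgD; first exact: cvg_cst.
  apply: cvgM; first exact: cvg_cst.
  apply: cvgD; first exact: cvgy_div_den.
  by apply: cvgM; [exact: cvg_cst|exact: cvgy_denV].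
rewrite !(mulr0, addr0) in h; apply: cvg_trans h; apply: near_eq_cvg.
near=> w; have := den_neq0 w; rewrite /den => den0.
by field.
Unshelve. all: by end_near. Qed.

Let pole_primitive (w : R) : R[i] :=
  atan ((w - y) / - x) +i* (- (1 / 2) * ln (den w)).

(** With z = x + iy and x < 0 the real part of 1/(iw - z) is the derivative of
    atan ((w - y) / - x), whose total variation is pi. The imaginary part has a
    logarithmic primitive, and its values at w and -w cancel in the limit. *)
Lemma cplx_pv_pole1 : cplx_pv (pole z) pi%:C.
Proof.
have cp := cplx_deriv_continuous cplx_deriv_pole1.
apply: (@cplx_pv_primitive _ pole_primitive) => [w|w||];
  [exact: (cp w).1|exact: (cp w).2| |].
- move=> w; split; rewrite ?poleRe ?poleIm.
  + have h : is_derive w (1 : R) (fun v => (v - y) * (- x)^-1) (- x)^-1.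
      have h := is_deriveZ (- x)^-1 (is_derive_sub w).
      rewrite (_ : (fun _ => _) = (- x)^-1 \*: (fun v => v - y)).
        by apply: is_derive_conv h _; rewrite /GRing.scale /= mulr1.
      by apply/funext => v; rewrite mulrC.
    have h2 := @is_derive1_comp R (@atan R) (fun v => (v - y) / - x) w _ _
      (is_derive1_atan ((w - y) / - x)) h.
    apply: is_derive_conv h2 _; rewrite /= -/(den w).
    have xN0 : - x != 0 by rewrite oppr_eq0 lt_eqF.
    have nz : 1 + ((w - y) / - x) ^+ 2 != 0 by rewrite gt_eqF // ltr_pwDl // sqr_ge0.
    apply: (mulfI nz); rewrite mulrA mulfV // mul1r.
    apply: (mulIf (den_neq0 w)); rewrite -!mulrA mulVf // mulr1.
    by rewrite /den; field; rewrite lt_eqF.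
  + have h := @is_derive1_comp R (@ln R) den w _ _
      (is_derive1_ln (den_gt0 w)) (is_derive_den w).
    have h2 := is_deriveZ (- (1 / 2)) h.
    apply: is_derive_conv h2 _; rewrite /GRing.scale /= -/(den w).
    by field.
- split.
  + have h : (atan ((w - y) / - x) + atan ((w - - y) / - x)) @[w --> +oo] --> (pi : R).
      rewrite (splitr pi); apply: cvgD.
        exact: (cvg_comp _ _ (cvgy_scaled_sub y) (@cvgy_atan R)).
      exact: (cvg_comp _ _ (cvgy_scaled_sub (- y)) (@cvgy_atan R)).
    apply: cvg_ext h => w /=.
    rewrite -atanN; congr (_ + atan _).
    by field; rewrite lt_eqF.
  + have h : (1 / 2 * ln (den (- w) / den w)) @[w --> +oo] --> (0 : R).
      rewrite -(mulr0 (1 / 2)) -ln1; apply: cvgM; first exact: cvg_cst.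
      exact: (continuous_cvg _ (continuous_ln ltr01) cvgy_den_ratio).
    apply: cvg_ext h => w /=.
    by rewrite ln_div ?posrE //; ring.
Unshelve. all: by end_near. Qed.

End OnePole.

Lemma cplx_cvgM (f g : R -> R[i]) (F : set_system R) (l k : R[i]) : Filter F ->
  cplx_cvg f F l -> cplx_cvg g F k -> cplx_cvg (fun w => f w * g w) F (l * k).
Proof.
move=> FF [fr fi] [gr gi]; split.
- have h : complex.Re (f w) * complex.Re (g w) - complex.Im (f w) * complex.Im (g w)
      @[w --> F] --> complex.Re l * complex.Re k - complex.Im l * complex.Im k.
    exact: cvgB (cvgM fr gr) (cvgM fi gi).
  have -> : complex.Re (l * k) =
      complex.Re l * complex.Re k - complex.Im l * complex.Im k.
    by case: l k {fr fi gr gi h} => ? ? [].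
  apply: cvg_ext h => w.
  by case: (f w) (g w) => ? ? [].
- have h : complex.Re (f w) * complex.Im (g w) + complex.Im (f w) * complex.Re (g w)
      @[w --> F] --> complex.Re l * complex.Im k + complex.Im l * complex.Re k.
    exact: cvgD (cvgM fr gi) (cvgM fi gr).
  have -> : complex.Im (l * k) =
      complex.Re l * complex.Im k + complex.Im l * complex.Re k.
    by case: l k {fr fi gr gi h} => ? ? [].
  apply: cvg_ext h => w.
  by case: (f w) (g w) => ? ? [].
Unshelve. all: by end_near. Qed.

Lemma cplx_cvgD (f g : R -> R[i]) (F : set_system R) (l k : R[i]) : Filter F ->
  cplx_cvg f F l -> cplx_cvg g F k -> cplx_cvg (fun w => f w + g w) F (l + k).
Proof.
move=> FF [fr fi] [gr gi]; split.
- have h : complex.Re (f w) + complex.Re (g w) @[w --> F] -->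
      complex.Re l + complex.Re k by exact: cvgD fr gr.
  have -> : complex.Re (l + k) = complex.Re l + complex.Re k.
    by case: l k {fr fi gr gi h} => ? ? [].
  apply: cvg_ext h => w.
  by case: (f w) (g w) => ? ? [].
- have h : complex.Im (f w) + complex.Im (g w) @[w --> F] -->
      complex.Im l + complex.Im k by exact: cvgD fi gi.
  have -> : complex.Im (l + k) = complex.Im l + complex.Im k.
    by case: l k {fr fi gr gi h} => ? ? [].
  apply: cvg_ext h => w.
  by case: (f w) (g w) => ? ? [].
Qed.

Lemma cplx_cvg_cst (F : set_system R) (l : R[i]) : Filter F -> cplx_cvg (fun=> l) F l.
Proof. by move=> FF; split; exact: cvg_cst. Qed.

Section PoleTheory.
Variables (z : R[i]).
Hypothesis z_lt0 : complex.Re z < 0.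

Lemma cplx_pv_pole : cplx_pv (pole z) pi%:C.
Proof. by case: z z_lt0 => x y /= x0; exact: cplx_pv_pole1. Qed.

Lemma cplx_deriv_pole : cplx_deriv (pole z) (fun w => - 'i * pole z w ^+ 2).
Proof. by case: z z_lt0 => x y /= x0; exact: cplx_deriv_pole1. Qed.

Lemma cplx_cvgy_pole : cplx_cvg (pole z) +oo 0.
Proof. by case: z z_lt0 => x y /= x0; exact: cplx_cvgy_pole1. Qed.

End PoleTheory.

(** Reduces limits at minus infinity to limits at plus infinity. *)
Lemma pole_opp z (w : R) : pole z (- w) = (pole z^* w)^*.
Proof.
case: z => x y; rewrite /pole conjc_inv; congr (_^-1).
by apply/eqP; rewrite eq_complex /=; apply/andP; split; apply/eqP; ring.
Qed.

Lemma cplx_cvgy_pole_opp z : complex.Re z < 0 -> cplx_cvg (fun w => pole z (- w)) +oo 0.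
Proof.
move=> z0; have [|r i] := @cplx_cvgy_pole z^*; first by case: z z0.
rewrite (_ : (fun w => _) = (fun w => (pole z^* w)^*)); last first.
  by apply/funext => w; rewrite pole_opp.
split.
- by apply: cvg_ext r => w; case: (pole _ _).
- have {}i : (- complex.Im (pole z^* w)) @[w --> +oo] --> (0 : R).
    by rewrite -oppr0; exact: cvgN i.
  by apply: cvg_ext i => w; case: (pole _ _).
Unshelve. all: by end_near. Qed.

Lemma cplx_cvgX (f : R -> R[i]) (F : set_system R) n : Filter F ->
  cplx_cvg f F 0 -> cplx_cvg (fun w => f w ^+ n.+1) F 0.
Proof.
move=> FF f0; elim: n => [|n IH]; first by [].
rewrite (_ : (fun w => _) = (fun w => f w * f w ^+ n.+1)).
  by rewrite -(mulr0 0); exact: cplx_cvgM.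
by apply/funext => w; rewrite exprS.
Qed.

(** For exponent at least 2 a power of the pole has a lower power of it as
    primitive, up to a factor, and this vanishes at both ends. *)
Lemma cplx_pv_poleX z n : complex.Re z < 0 -> cplx_pv (fun w => pole z w ^+ n.+2) 0.
Proof.
move=> z0.
have D := cplx_derivX n.+1 (cplx_deriv_pole z0).
apply: (@cplx_pv_primitive _ (fun w => 'i / n.+1%:R * pole z w ^+ n.+1)) => [w|w||].
- exact: (cplx_deriv_continuous D w).1.
- exact: (cplx_deriv_continuous D w).2.
- apply: eq_cplx_deriv (cplx_derivZ ('i / n.+1%:R)
    (cplx_derivX n (cplx_deriv_pole z0))) => w //.
  have i2 : 'i * 'i = -1 :> R[i] by rewrite -expr2 sqr_i.
  transitivity (- ('i * 'i) * (pole z w ^+ n * pole z w ^+ 2)).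
    by field; rewrite addrC natr1 pnatr_eq0.
  by rewrite i2 opprK mul1r -exprD addn2.
- have h1 : cplx_cvg (fun w => pole z w ^+ n.+1) +oo 0.
    by apply: cplx_cvgX; exact: cplx_cvgy_pole.
  have h2 : cplx_cvg (fun w => pole z (- w) ^+ n.+1) +oo 0.
    by apply: cplx_cvgX; exact: cplx_cvgy_pole_opp.
  pose c : R[i] := 'i / n.+1%:R.
  rewrite (_ : (fun t => _) =
      (fun t => c * pole z t ^+ n.+1 + - c * pole z (- t) ^+ n.+1)); last first.
    by apply/funext => w; rewrite mulNr.
  rewrite (_ : 0 = c * 0 + - c * 0); last by rewrite !mulr0 addr0.
  by apply: cplx_cvgD; apply: cplx_cvgM => //; exact: cplx_cvg_cst.
Qed.

Lemma sub_pole_neq0 z (w : R) : complex.Re z < 0 -> 0 +i* w - z != 0.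
Proof.
case: z => x y /= x0; rewrite eq_complex /= negb_and sub0r oppr_eq0.
by rewrite lt_eqF.
Qed.

Lemma pole_mul z1 z2 (w : R) : complex.Re z1 < 0 -> complex.Re z2 < 0 -> z1 != z2 ->
  pole z1 w * pole z2 w = (z1 - z2)^-1 * pole z1 w + - (z1 - z2)^-1 * pole z2 w.
Proof.
move=> h1 h2 h12; have := sub_pole_neq0 w h1; have := sub_pole_neq0 w h2.
rewrite /pole; set s := 0 +i* w => s1 s2.
by field; rewrite s1 s2 subr_eq0 h12.
Qed.

(** Induction on the number of poles. If two of them differ, partial fractions
    write the product as a multiple of the difference of two products with one
    pole fewer; these have the same principal value, so the difference has
    principal value 0. If all are equal, the product is a power. *)
Lemma cplx_pv_prod_poles (s : seq R[i]) : s != [::] ->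
  all (fun z => complex.Re z < 0) s ->
  cplx_pv (fun w => \prod_(z <- s) pole z w) (if size s == 1 then pi%:C else 0).
Proof.
have [n] := ubnP (size s); elim: n s => // n IH [//|z1 [|z2 s]] sz _.
  move=> /=/andP[z0 _]; apply: eq_cplx_pv (cplx_pv_pole z0) => w.
  by rewrite big_seq1.
move=> /= /andP[z10 /andP[z20 s0]].
(* Either every pole is the first one, or some z differs from it. *)
have [/allP eq_s|] := boolP (all (pred1 z1) (z2 :: s)).
  apply: eq_cplx_pv (cplx_pv_poleX (size s) z10) => w.
  rewrite big_cons exprS; congr (_ * _).
  rewrite (eq_big_seq (fun=> pole z1 w)); last by move=> z /eq_s /eqP ->.
  by rewrite big_const_seq count_predT iter_mulr_1.
move=> /allPn[z zs /= z1z].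
have z0 : complex.Re z < 0 by move: zs; rewrite inE => /orP[/eqP ->|/(allP s0)].
have E := perm_to_rem zs.
set s' := rem z (z2 :: s) in E.
have ss' : size s' = size s by rewrite size_rem.
have s'0 : all (fun z => complex.Re z < 0) s'.
  by apply/allP => u /mem_rem; rewrite inE => /orP[/eqP ->|/(allP s0)].
have sz' t : (size (t :: s') < n)%N by rewrite /= ss'; move: sz; rewrite /= ltnS.
have H t : complex.Re t < 0 -> cplx_pv (fun w => \prod_(z <- t :: s') pole z w)
    (if size (t :: s') == 1 then pi%:C else 0).
  by move=> t0; apply: IH; [exact: sz'|by []|rewrite /= t0].
have := cplx_pv_lin (z1 - z)^-1 (- (z1 - z)^-1) (H _ z10) (H _ z0).
rewrite /= mulNr subrr; apply: eq_cplx_pv => w.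
rewrite [RHS]big_cons (perm_big _ E) /= -/s' !big_cons [RHS]mulrA.
by rewrite pole_mul 1?eq_sym //; ring.
Qed.

End Poles.

(** * The principal value of the resolvent *)

Section MatrixPrincipalValue.
Variable R : realType.
Local Open Scope complex_scope.

Definition mx_pv (k l : nat) (F : R -> 'M[R[i]]_(k, l)) (L : 'M[R[i]]_(k, l)) : Prop :=
  forall i j, cplx_pv (fun w => F w i j) (L i j).

Lemma eq_mx_pv k l (F G : R -> 'M[R[i]]_(k, l)) L : F =1 G -> mx_pv F L -> mx_pv G L.
Proof. by move=> /funext ->. Qed.

Lemma mx_pvD k l (F G : R -> 'M[R[i]]_(k, l)) L M : mx_pv F L -> mx_pv G M ->
  mx_pv (fun w => F w + G w) (L + M).
Proof.
move=> FL GM i j; rewrite mxE; apply: eq_cplx_pv (cplx_pvD (FL i j) (GM i j)) => w.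
by rewrite mxE.
Qed.

Lemma mx_pv_mull h k l (M : 'M[R[i]]_(h, k)) (F : R -> 'M[R[i]]_(k, l)) L :
  mx_pv F L -> mx_pv (fun w => M *m F w) (M *m L).
Proof.
move=> FL i j; rewrite mxE.
apply: eq_cplx_pv (cplx_pv_sum _ (fun t => cplx_pvZ (M i t) (FL t j))) => w.
by rewrite mxE.
Qed.

Lemma mx_pv_tr k l (F : R -> 'M[R[i]]_(k, l)) L :
  mx_pv F L -> mx_pv (fun w => (F w)^T) L^T.
Proof.
by move=> FL i j; rewrite mxE; apply: eq_cplx_pv (FL j i) => w; rewrite mxE.
Qed.

Lemma mx_pv_mulr h k l (F : R -> 'M[R[i]]_(h, k)) L (M : 'M[R[i]]_(k, l)) :
  mx_pv F L -> mx_pv (fun w => F w *m M) (L *m M).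
Proof.
move=> /mx_pv_tr /(mx_pv_mull M^T) /mx_pv_tr; rewrite trmx_mul !trmxK.
by apply: eq_mx_pv => w; rewrite trmx_mul !trmxK.
Qed.

Lemma mx_pv_conj k l (F : R -> 'M[R[i]]_(k, l)) L :
  mx_pv F L -> mx_pv (fun w => map_mx conjc (F w)) (map_mx conjc L).
Proof.
by move=> FL i j; rewrite mxE; apply: eq_cplx_pv (cplx_pv_conj (FL i j)) => w;
  rewrite mxE.
Qed.

Lemma mx_pv_unique k l (F : R -> 'M[R[i]]_(k, l)) L M : mx_pv F L -> mx_pv F M -> L = M.
Proof. by move=> FL FM; apply/matrixP => i j;
  exact: cplx_pv_unique (FL i j) (FM i j). Qed.

Lemma mx_pv_trace k (F : R -> 'M[R[i]]_k) L : mx_pv F L ->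
  cplx_pv (fun w => \tr (F w)) (\tr L).
Proof. by move=> FL; exact: cplx_pv_sum (fun t => FL t t). Qed.

Definition resolvent (k : nat) (A : 'M[R]_k) (w : R) : 'M[R[i]]_k :=
  invmx ((0 +i* w)%:M - mxC A).

Lemma eigenvalue_unitmx (F : fieldType) k (M : 'M[F]_k) (a : F) :
  eigenvalue M a = (a%:M - M \notin unitmx).
Proof.
rewrite /eigenvalue /eigenspace kermx_eq0 row_free_unit -opprB -scaleN1r.
by rewrite unitmxZ // unitrN1.
Qed.

Section Stable.
Variables (k : nat) (A : 'M[R]_k).
Hypothesis stA : stable A.

Lemma resolvent_unit (w : R) : (0 +i* w)%:M - mxC A \in unitmx.
Proof.
have := @eigenvalue_unitmx _ _ (mxC A) (0 +i* w).
by case: (_ \in unitmx) => // /stA /=; rewrite ltxx.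
Qed.

Lemma mulmx_resolvent (w : R) : ((0 +i* w)%:M - mxC A) *m resolvent A w = 1%:M.
Proof. exact: mulmxV (resolvent_unit w). Qed.

Lemma resolvent_mulmx (w : R) : resolvent A w *m ((0 +i* w)%:M - mxC A) = 1%:M.
Proof. exact: mulVmx (resolvent_unit w). Qed.

End Stable.

(** With z_1, z_2, ... the roots of the characteristic polynomial and
    p_s(x) the product of the x - z over z in s, the identity
    H - p_(s z)(A) H / p_(s z)(iw) = (H - p_s(A) H / p_s(iw)) + p_s(A) / p_(s z)(iw)
    accumulates a combination of products of poles. By Cayley-Hamilton
    the subtracted term vanishes once s contains all the roots. Only the first
    summand, a single pole times the identity, contributes. *)
Lemma mx_pv_resolventS k (A : 'M[R]_k.+1) : stable A ->
  mx_pv (resolvent A) (pi%:C%:M).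
Proof.
move=> stA; set Ac := mxC A.
pose P (s : seq R[i]) : 'M[R[i]]_k.+1 := \prod_(z <- s) (Ac - z%:M).
have key (s : seq R[i]) : all (fun z => complex.Re z < 0) s ->
    mx_pv (fun w => resolvent A w -
           (\prod_(z <- s) pole z w) *: (P s *m resolvent A w))
        (if s is [::] then 0 else pi%:C%:M).
  elim/last_ind: s => [_|s z IH].
    move=> i j; rewrite mxE; apply: eq_cplx_pv (cplx_pv0 R) => w.
    by rewrite /P !big_nil mul1mx scale1r subrr mxE.
  rewrite all_rcons => /andP[z0 s0].
  have sz0 : all (fun z => complex.Re z < 0) (rcons s z) by rewrite all_rcons z0.
  have := cplx_pv_prod_poles _ sz0; rewrite size_rcons.
  have -> : (rcons s z != [::]) by case: s {IH s0 sz0}.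
  move=> /(_ isT) Hp.
  have {IH s0}H1 := IH s0.
  have H2 : mx_pv (fun w => (\prod_(t <- rcons s z) pole t w) *: P s)
      ((if (size s).+1 == 1 then pi%:C else 0) *: P s).
    move=> i j; rewrite !mxE mulrC; apply: eq_cplx_pv (cplx_pvZ (P s i j) Hp) => w.
    by rewrite mxE mulrC.
  have H := mx_pvD H1 H2.
  have -> : (if rcons s z is [::] then 0 else pi%:C%:M) =
      (if s is [::] then 0 else pi%:C%:M) +
      (if (size s).+1 == 1 then pi%:C else 0) *: P s.
    case: s {Hp H1 H2 H sz0} => [|t s] /=.
      by rewrite add0r /P big_nil; exact/esym/scalemx1.
    by rewrite scale0r addr0.
  apply: eq_mx_pv H => w.
  have -> : P (rcons s z) = P s *m (Ac - z%:M) by rewrite /P big_rcons.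
  rewrite big_rcons /=.
  set q := \prod_(t <- s) pole t w; set H := resolvent A w.
  have Z : pole z w *: ((Ac - z%:M) *m H) = H - (pole z w)%:M.
    have -> : Ac - z%:M = (0 +i* w - z)%:M - ((0 +i* w)%:M - Ac).
      by rewrite raddfB /= opprB [RHS]addrC addrA subrK.
    rewrite mulmxBl mul_scalar_mx mulmx_resolvent // scalerBr scalerA.
    by rewrite /pole mulVf ?sub_pole_neq0 // scale1r scalemx1.
  have {}Z : pole z w *: (P s *m (Ac - z%:M) *m H) = P s *m H - pole z w *: P s.
    by rewrite -mulmxA scalemxAr Z mulmxBr mul_mx_scalar.
  by rewrite -!scalerA Z scalerBr opprB addrA addrAC.
have [r Er] := closed_field_poly_normal (char_poly Ac).
rewrite (monicP (char_poly_monic Ac)) scale1r in Er.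
have rlt0 : all (fun z => complex.Re z < 0) r.
  apply/allP => z zr; apply: stA.
  by rewrite eigenvalue_root_char Er root_prod_XsubC.
have P0 : P r = 0.
  rewrite -(Cayley_Hamilton Ac) Er rmorph_prod; apply: eq_bigr => z _.
  by rewrite rmorphB /= horner_mx_X horner_mx_C.
have := key r rlt0; rewrite P0.
have -> : (if r is [::] then 0 else pi%:C%:M) = pi%:C%:M :> 'M[R[i]]_k.+1.
  case: r P0 {Er rlt0} => // /eqP.
  by rewrite /P big_nil oner_eq0.
by apply: eq_mx_pv => w; rewrite mul0mx scaler0 subr0.
Qed.

Lemma mx_pv_resolvent k (A : 'M[R]_k) : stable A -> mx_pv (resolvent A) (pi%:C%:M).
Proof. by case: k A => [A _ []//|k A]; exact: mx_pv_resolventS. Qed.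

End MatrixPrincipalValue.

(** * The Lyapunov equation and the H2 norm *)

Section Lyapunov.
Variable R : realType.
Local Open Scope complex_scope.

Lemma ReD (a b : R[i]) : complex.Re (a + b) = complex.Re a + complex.Re b.
Proof. by case: a b => ? ? []. Qed.

Lemma Re_sum (I : Type) (r : seq I) (F : I -> R[i]) :
  complex.Re (\sum_(i <- r) F i) = \sum_(i <- r) complex.Re (F i).
Proof. exact: (big_morph _ ReD (erefl _)). Qed.

Lemma mxCM k l h (M : 'M[R]_(k, l)) (N : 'M[R]_(l, h)) :
  mxC (M *m N) = mxC M *m mxC N.
Proof. exact: (map_mxM (real_complex R)). Qed.

Lemma mxCD k l (M N : 'M[R]_(k, l)) : mxC (M + N) = mxC M + mxC N.
Proof. exact: (map_mxD (real_complex R)). Qed.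

Lemma mxCN k l (M : 'M[R]_(k, l)) : mxC (- M) = - mxC M.
Proof. exact: (map_mxN (real_complex R)). Qed.

Lemma mxC_tr k l (M : 'M[R]_(k, l)) : (mxC M)^T = mxC M^T.
Proof. by rewrite /mxC map_trmx. Qed.

Lemma conj_mxC k l (M : 'M[R]_(k, l)) : map_mx conjc (mxC M) = mxC M.
Proof. by apply/matrixP => i j; rewrite !mxE conjc_real. Qed.

Definition adjoint_mx k l (M : 'M[R[i]]_(k, l)) : 'M[R[i]]_(l, k) := (map_mx conjc M)^T.

Lemma adjoint_mxM k l h (M : 'M[R[i]]_(k, l)) (N : 'M[R[i]]_(l, h)) :
  adjoint_mx (M *m N) = adjoint_mx N *m adjoint_mx M.
Proof. by rewrite /adjoint_mx map_mxM trmx_mul. Qed.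

Lemma adjoint_mxK k l (M : 'M[R[i]]_(k, l)) : adjoint_mx (adjoint_mx M) = M.
Proof. by apply/matrixP => i j; rewrite !mxE conjcK. Qed.

Lemma adjoint_mxC k l (M : 'M[R]_(k, l)) : adjoint_mx (mxC M) = mxC M^T.
Proof. by rewrite /adjoint_mx conj_mxC mxC_tr. Qed.

Lemma mx_pv_adj k l (F : R -> 'M[R[i]]_(k, l)) L :
  mx_pv F L -> mx_pv (fun w => adjoint_mx (F w)) (adjoint_mx L).
Proof. by move=> FL; exact/mx_pv_tr/mx_pv_conj. Qed.

Lemma mul_ii : 'i * 'i = -1 :> R[i].
Proof. by rewrite -expr2 sqr_i. Qed.

(** Reduces complex vectors to pairs of real ones. *)
Lemma hermitian_form_Re k (S : 'M[R]_k) (v : 'cV[R[i]]_k) :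
  complex.Re ((adjoint_mx v *m mxC S *m v) 0 0) =
  ((map_mx (@complex.Re R) v)^T *m S *m map_mx (@complex.Re R) v) 0 0 +
  ((map_mx (@complex.Im R) v)^T *m S *m map_mx (@complex.Im R) v) 0 0.
Proof.
set a := map_mx (@complex.Re R) v; set b := map_mx (@complex.Im R) v.
have -> : v = mxC a + 'i *: mxC b.
  apply/matrixP => i j; rewrite !mxE; case: (v i j) => x y.
  by apply/eqP; rewrite eq_complex /=; apply/andP; split; apply/eqP; ring.
have -> : adjoint_mx (mxC a + 'i *: mxC b) = mxC a^T - 'i *: mxC b^T.
  apply/matrixP => i j; rewrite !mxE.
  by apply/eqP; rewrite eq_complex /=; apply/andP; split; apply/eqP; ring.
rewrite mulmxBl mulmxBl !mulmxDr -!scalemxAl -!scalemxAr -!mxCM scalerA mul_ii.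
by rewrite !mxE /=; ring.
Qed.


Lemma psd_hermitian_ge0 k (S : 'M[R]_k) (v : 'cV[R[i]]_k) : psd S ->
  0 <= complex.Re ((adjoint_mx v *m mxC S *m v) 0 0).
Proof. by move=> [_ S0]; rewrite hermitian_form_Re addr_ge0. Qed.

Section Stable.
Variables (k : nat) (A : 'M[R]_k).
Hypothesis stA : stable A.

Lemma adjoint_resolvent (w : R) :
  (- (0 +i* w)%:M - mxC A^T) *m adjoint_mx (resolvent A w) = 1%:M.
Proof.
have := congr1 (@adjoint_mx _ _) (resolvent_mulmx stA w).
rewrite adjoint_mxM => h; rewrite -[RHS](_ : adjoint_mx 1%:M = _).
  rewrite -h; congr (_ *m _);
    rewrite /adjoint_mx map_mxB raddfB /= -/(adjoint_mx (mxC A)) adjoint_mxC.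
  congr (_ - _); apply/matrixP => i j; rewrite !mxE eq_sym; case: (_ == _).
    by rewrite !mulr1n; apply/eqP; rewrite eq_complex /= oppr0 !eqxx.
  by rewrite !mulr0n oppr0 conjc0.
by rewrite /adjoint_mx map_mx1 trmx1.
Qed.

(** S = (iw - A) L + L (- iw - A^T), and the two factors are inverted by the
    resolvent H and its adjoint, so that H S H^* = L H^* + H L. *)
Lemma mx_pv_lyapunov (L S : 'M[R]_k) : A *m L + L *m A^T = - S ->
  mx_pv (fun w => resolvent A w *m mxC S *m adjoint_mx (resolvent A w))
      ((2 * pi)%:C *: mxC L).
Proof.
move=> ALS.
have H1 := mx_pv_resolvent stA; have H2 := mx_pv_adj H1.
have H := mx_pvD (mx_pv_mull (mxC L) H2) (mx_pv_mulr (mxC L) H1).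
have -> : (2 * pi)%:C *: mxC L = mxC L *m adjoint_mx (pi%:C%:M) + pi%:C%:M *m mxC L.
  have -> : adjoint_mx (pi%:C%:M) = (pi%:C)%:M :> 'M[R[i]]_k.
    rewrite /adjoint_mx map_scalar_mx tr_scalar_mx; congr (_%:M).
    exact: conjc_real.
  rewrite mul_scalar_mx mul_mx_scalar -scalerDl.
  by rewrite mulr_natl mulr2n rmorphD.
apply: eq_mx_pv H => w; pose s : 'M[R[i]]_k := (0 +i* w)%:M.
have -> : mxC S = (s - mxC A) *m mxC L + mxC L *m (- s - mxC A^T).
  rewrite mulmxBl mulmxBr mulmxN /s mul_scalar_mx mul_mx_scalar.
  rewrite -[S]opprK -ALS mxCN mxCD !mxCM; set x := _ *: _.
  by rewrite opprD addrACA subrr add0r.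
rewrite mulmxDr mulmxDl !mulmxA resolvent_mulmx // mul1mx; congr (_ + _).
by rewrite -!mulmxA adjoint_resolvent mulmx1.
Qed.

(** For S = 0 the function of [mx_pv_lyapunov] vanishes identically, and its
    principal value is 2 pi L. *)
Lemma lyapunov_inj (L : 'M[R]_k) : A *m L + L *m A^T = 0 -> L = 0.
Proof.
move=> AL0; have H := mx_pv_lyapunov (etrans AL0 (esym (oppr0 _))).
have H0 : mx_pv (fun w => resolvent A w *m mxC 0 *m adjoint_mx (resolvent A w)) 0.
  move=> i j; rewrite mxE; apply: eq_cplx_pv (cplx_pv0 R) => w.
  by rewrite (_ : mxC 0 = 0) ?mulmx0 ?mul0mx ?mxE // /mxC map_mx0.
have /matrixP E := mx_pv_unique H H0; apply/matrixP => i j.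
have := E i j; rewrite !mxE => /eqP; rewrite mulf_eq0 => /orP[] /eqP/complexI.
  by move=> /eqP; rewrite mulf_eq0 pnatr_eq0 /= gt_eqF // pi_gt0.
by [].
Qed.

(** An injective endomorphism of a finite dimensional space is surjective. *)
Lemma lyapunov_solvable (S : 'M[R]_k) : exists L, A *m L + L *m A^T = - S.
Proof.
pose f := lin_mx (mulmx A \+ mulmxr A^T).
have f_free : row_free f.
  apply: inj_row_free => v; rewrite -[v]vec_mxK mul_vec_lin /= => /eqP.
  rewrite mxvec_eq0 => /eqP /lyapunov_inj ->.
  by rewrite linear0.
exists (vec_mx (mxvec (- S) *m invmx f)).
apply: (can_inj mxvecK); rewrite -[X in mxvec X]/((mulmx A \+ mulmxr A^T) _).
by rewrite -mul_vec_lin vec_mxK mulmxKV // -row_free_unit.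
Qed.

Lemma lyapunov_sym (L S : 'M[R]_k) : S^T = S -> A *m L + L *m A^T = - S -> L^T = L.
Proof.
move=> Ssym ALS; apply/eqP; rewrite -subr_eq0; apply/eqP/lyapunov_inj.
have ALSt : A *m L^T + L^T *m A^T = - S.
  have := congr1 trmx ALS; rewrite !linearD /= linearN /= Ssym !trmx_mul !trmxK.
  by rewrite addrC.
by rewrite mulmxBr mulmxBl addrACA -opprD ALS ALSt subrr.
Qed.

(** 2 pi x^T L x is the integral of the nonnegative function
    (H^* x)^* S (H^* x). *)
Lemma lyapunov_psd (L S : 'M[R]_k) : psd S -> A *m L + L *m A^T = - S -> psd L.
Proof.
move=> S_psd ALS; split; first exact: lyapunov_sym S_psd.1 ALS.
move=> x; have H := mx_pv_mull (mxC x^T) (mx_pv_mulr (mxC x) (mx_pv_lyapunov ALS)).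
have [Hr _] := H 0 0.
have E : complex.Re ((mxC x^T *m ((2 * pi)%:C *: mxC L *m mxC x)) 0 0) =
    2 * pi * (x^T *m L *m x) 0 0.
  rewrite -scalemxAl -scalemxAr -!mxCM mulmxA mxE [(mxC _) 0 0]mxE.
  by rewrite /= mul0r subr0.
rewrite -(@pmulr_rge0 _ (2 * pi)) -?E; last by rewrite mulr_gt0 // pi_gt0.
apply: real_pv_ge0 Hr => w.
have -> : mxC x^T *m (resolvent A w *m mxC S *m adjoint_mx (resolvent A w) *m mxC x) =
   adjoint_mx (adjoint_mx (resolvent A w) *m mxC x) *m mxC S *m
     (adjoint_mx (resolvent A w) *m mxC x).
  by rewrite adjoint_mxM adjoint_mxC adjoint_mxK !mulmxA.
exact: psd_hermitian_ge0.
Qed.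

(** Up to a cyclic permutation under the trace, the integrand is the function of
    [mx_pv_lyapunov] with S = B B^T. *)
Lemma h2norm_gramian (m p : nat) (B : 'M[R]_(k, m)) (C : 'M[R]_(p, k)) (L : 'M[R]_k) :
  A *m L + L *m A^T = - (B *m B^T) ->
  h2norm (fun s => mxC C *m invmx (s%:M - mxC A) *m mxC B) =
  Num.sqrt (\tr (C *m L *m C^T)).
Proof.
move=> ALS; rewrite /h2norm; congr Num.sqrt.
have H := mx_pv_mull (mxC C) (mx_pv_mulr (mxC C^T) (mx_pv_lyapunov ALS)).
have [Hr _] := mx_pv_trace H.
have pi2 : 2 * pi != 0 :> R by rewrite gt_eqF // mulr_gt0 // pi_gt0.
apply: (mulfI pi2); rewrite mulrA mulfV // mul1r.
have -> : 2 * pi * \tr (C *m L *m C^T) =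
    complex.Re (\tr (mxC C *m ((2 * pi)%:C *: mxC L *m mxC C^T))).
  rewrite -scalemxAl -scalemxAr -!mxCM mxtraceZ mulmxA.
  have -> : \tr (mxC (C *m L *m C^T)) = (\tr (C *m L *m C^T))%:C.
    by rewrite rmorph_sum; apply: eq_bigr => i _; rewrite mxE.
  by rewrite /= mul0r subr0.
apply: integral_real_pv.
  move=> w; rewrite Re_sum; apply: sumr_ge0 => i _; rewrite mxE Re_sum.
  apply: sumr_ge0 => j _; rewrite !mxE; case: (\sum_(_ <- _) _) => a b /=.
  have := sqr_ge0 a; have := sqr_ge0 b; nra.
apply: eq_real_pv Hr => w; congr complex.Re.
rewrite -/(resolvent A w) -/(adjoint_mx _) [RHS]mxtrace_mulC.
rewrite !adjoint_mxM !adjoint_mxC mxCM !mulmxA.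
by [].
Qed.

End Stable.
End Lyapunov.

(** * Semidefinite matrices *)

Section Semidefinite.
Variable R : realType.
Local Open Scope complex_scope.

Lemma psd_congr k l (M : 'M[R]_k) (T : 'M[R]_(k, l)) :
  psd M -> psd (T^T *m M *m T).
Proof.
move=> [Ms M0]; split=> [|x]; first by rewrite !trmx_mul trmxK Ms mulmxA.
by have := M0 (T *m x); rewrite trmx_mul !mulmxA.
Qed.

Lemma psd_congr_unit k (M T : 'M[R]_k) : T \in unitmx ->
  psd (T^T *m M *m T) -> psd M.
Proof.
move=> Tu /(@psd_congr _ _ _ (invmx T)).
by rewrite -!mulmxA mulmxV // mulmx1 mulmxA -trmx_mul mulmxV // trmx1 mul1mx.
Qed.

Lemma psdD k (M N : 'M[R]_k) : psd M -> psd N -> psd (M + N).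
Proof.
move=> [Ms M0] [Ns N0]; split=> [|x]; first by rewrite linearD /= Ms Ns.
by rewrite mulmxDr mulmxDl mxE addr_ge0.
Qed.

Lemma psdZ k (a : R) (M : 'M[R]_k) : 0 <= a -> psd M -> psd (a *: M).
Proof.
move=> a0 [Ms M0]; split=> [|x]; first by rewrite linearZ /= Ms.
by rewrite -scalemxAr -scalemxAl mxE mulr_ge0.
Qed.

Lemma mx11_sum k (x y : 'cV[R]_k) : (x^T *m y) 0 0 = \sum_i x i 0 * y i 0.
Proof. by rewrite mxE; apply: eq_bigr => i _; rewrite mxE. Qed.

Lemma dot_ge0 k (x : 'cV[R]_k) : 0 <= (x^T *m x) 0 0.
Proof. by rewrite mx11_sum; apply: sumr_ge0 => i _; rewrite -expr2 sqr_ge0. Qed.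

Lemma dot_gt0 k (x : 'cV[R]_k) : x != 0 -> 0 < (x^T *m x) 0 0.
Proof.
move=> x0; rewrite lt_def dot_ge0 andbT; apply: contraNneq x0.
rewrite mx11_sum => /eqP; rewrite psumr_eq0; last first.
  by move=> i _; rewrite -expr2 sqr_ge0.
move=> /allP h; apply/eqP/matrixP => i j; rewrite (ord1 j) mxE.
by have := h i (mem_index_enum _); rewrite mulf_eq0 orbb => /eqP.
Qed.

Lemma psd_mxgram k l (T : 'M[R]_(k, l)) : psd (T^T *m T).
Proof.
split=> [|x]; first by rewrite trmx_mul trmxK.
by have := dot_ge0 (T *m x); rewrite trmx_mul !mulmxA.
Qed.

Lemma psd_trace_ge0 k (M : 'M[R]_k) : psd M -> 0 <= \tr M.
Proof.
move=> [_ M0]; apply: sumr_ge0 => i _.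
have := M0 (delta_mx i 0); rewrite trmx_delta -rowE mxE.
under eq_bigr do rewrite !mxE eqxx andbT.
rewrite (bigD1 i) //= eqxx mulr1 big1 ?addr0 // => j /negbTE ->.
by rewrite mulr0.
Qed.

Lemma posdef_psd k (M : 'M[R]_k) : posdef M -> psd M.
Proof.
move=> [Ms M0]; split=> // x; have [->|/M0 /ltW //] := eqVneq x 0.
by rewrite mulmx0 mxE.
Qed.

Lemma unitmx_col_inj (F : fieldType) k (M : 'M[F]_k) :
  (forall x : 'cV_k, M *m x = 0 -> x = 0) -> M \in unitmx.
Proof.
move=> M_inj; rewrite -unitmx_tr -row_free_unit; apply: inj_row_free => v vM.
apply: trmx_inj; rewrite linear0; apply: M_inj.
by apply: trmx_inj; rewrite trmx_mul trmxK vM linear0.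
Qed.

Lemma posdef_unitmx k (M : 'M[R]_k) : posdef M -> M \in unitmx.
Proof.
move=> [_ M0]; apply: unitmx_col_inj => x Mx; apply/eqP; apply: contraT => /M0.
by rewrite -mulmxA Mx mulmx0 mxE ltxx.
Qed.

Lemma posdef_congr k (M T : 'M[R]_k) : T \in unitmx -> posdef M ->
  posdef (T^T *m M *m T).
Proof.
move=> Tu [Ms M0]; split=> [|x x0]; first by rewrite !trmx_mul trmxK Ms mulmxA.
have Tx0 : T *m x != 0.
  by apply: contraNneq x0 => Tx; rewrite -(mulKmx Tu x) Tx mulmx0.
by have := M0 _ Tx0; rewrite trmx_mul !mulmxA.
Qed.

Lemma trmx_inv_sym k (M : 'M[R]_k) : M^T = M -> (invmx M)^T = invmx M.
Proof. by move=> Ms; rewrite trmx_inv Ms. Qed.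

Lemma posdef_inv k (M : 'M[R]_k) : posdef M -> posdef (invmx M).
Proof.
move=> Mp; have Mu := posdef_unitmx Mp.
have := posdef_congr (_ : invmx M \in unitmx) Mp; rewrite unitmx_inv => /(_ Mu).
by rewrite (trmx_inv_sym Mp.1) mulVmx // mul1mx.
Qed.

Lemma posdefZ k (a : R) (M : 'M[R]_k) : 0 < a -> posdef M -> posdef (a *: M).
Proof.
move=> a0 [Ms M0]; split=> [|x x0]; first by rewrite linearZ /= Ms.
by rewrite -scalemxAr -scalemxAl mxE mulr_gt0 ?M0.
Qed.

Lemma posdefD k (M N : 'M[R]_k) : posdef M -> psd N -> posdef (M + N).
Proof.
move=> [Ms M0] [Ns N0]; split=> [|x x0]; first by rewrite linearD /= Ms Ns.
by rewrite mulmxDr mulmxDl mxE ltr_pwDl ?M0.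
Qed.

Lemma posdef1 k : posdef (1%:M : 'M[R]_k).
Proof. by split=> [|x x0]; rewrite ?trmx1 // mulmx1 dot_gt0. Qed.

(** Makes positive definiteness stable under small perturbations of the entries. *)
Lemma quad_form_bound k (E : 'M[R]_k) (x : 'cV[R]_k) :
  `|(x^T *m E *m x) 0 0| <= (\sum_i \sum_j `|E i j|) * (x^T *m x) 0 0.
Proof.
have xij i j : `|x i 0 * x j 0| <= (x^T *m x) 0 0.
  have leq (t : 'I_k) : x t 0 ^+ 2 <= (x^T *m x) 0 0.
    rewrite mx11_sum (bigD1 t) //= -expr2 lerDl.
    by apply: sumr_ge0 => u _; rewrite -expr2 sqr_ge0.
  move: (leq i) (leq j); move: (x i 0) (x j 0) ((x^T *m x) 0 0) => a b d ad bd.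
  rewrite ler_norml; have := sqr_ge0 (a - b); have := sqr_ge0 (a + b).
  by move=> h1 h2; apply/andP; split; lra.
rewrite -mulmxA mx11_sum.
under eq_bigr => i _ do rewrite mxE mulr_sumr.
rewrite mulr_suml; apply: le_trans (ler_norm_sum _ _ _) _; apply: ler_sum => i _.
rewrite mulr_suml; apply: le_trans (ler_norm_sum _ _ _) _; apply: ler_sum => j _.
by rewrite mulrCA normrM ler_wpM2l.
Qed.

Lemma posdef_hermitian_gt0 k (S : 'M[R]_k) (v : 'cV[R[i]]_k) : posdef S -> v != 0 ->
  0 < complex.Re ((adjoint_mx v *m mxC S *m v) 0 0).
Proof.
move=> Sp v0; rewrite hermitian_form_Re; have [_ S0] := posdef_psd Sp.
have [re0|re0] := eqVneq (map_mx (@complex.Re R) v) 0; last first.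
  by rewrite ltr_pwDl // Sp.2.
have [im0|im0] := eqVneq (map_mx (@complex.Im R) v) 0; last first.
  by rewrite ltr_wpDl // Sp.2.
case/eqP: v0; apply/matrixP => i j.
have /matrixP/(_ i j) := re0; have /matrixP/(_ i j) := im0; rewrite !mxE.
by case: (v i j) => a b /= -> ->.
Qed.

(** Lyapunov's criterion. For a left eigenvector v with eigenvalue z, the
    hermitian form of A L + L A^T at v is 2 Re z times the form of L. *)
Lemma lyapunov_stable k (A L : 'M[R]_k) : posdef L ->
  posdef (- (A *m L + L *m A^T)) -> stable A.
Proof.
move=> Lp Ap z /eigenvalueP[v vA v0].
pose u := adjoint_mx v; have vu : v = adjoint_mx u by rewrite /u adjoint_mxK.
have u0 : u != 0 by apply: contraNneq v0 => u0; rewrite vu u0 /adjoint_mx map_mx0 trmx0.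
have := posdef_hermitian_gt0 Ap u0; have := posdef_hermitian_gt0 Lp u0.
rewrite -vu mxCN mxCD !mxCM -mxC_tr.
have Au : (mxC A)^T *m u = z^* *: u.
  have := congr1 (@adjoint_mx _ _ _) vA; rewrite adjoint_mxM adjoint_mxC -mxC_tr => ->.
  by rewrite /adjoint_mx map_mxZ linearZ.
rewrite mulmxN mulNmx mulmxDr mulmxDl !mulmxA vA -scalemxAl -[_ *m _^T *m u]mulmxA Au.
rewrite -scalemxAr -scalemxAl -scalerDl.
move: (v *m mxC L *m u) => t; rewrite 2!mxE.
by case: (t 0 0) z {vA Au} => a b [x y] /=; nra.
Qed.
End Semidefinite.

(** * Matrix inequalities characterizing the H2 norm *)

Section H2LMI.
Variable R : realType.
Local Open Scope complex_scope.

(** The certificate conditions of non-degeneracy, for arbitrary system matrices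
    and an arbitrary level [g]. *)
Definition h2_lmi k m p (A : 'M[R]_k) (B : 'M[R]_(k, m)) (C : 'M[R]_(p, k))
    (g : R) (P : 'M[R]_k) (G : 'M[R]_p) : Prop :=
  [/\ nsd (block_mx (A^T *m P + P *m A) (P *m B) (B^T *m P) (- g%:M)),
      psd (block_mx P C^T C G) & \tr G <= g].

Definition transfer k m p (A : 'M[R]_k) (B : 'M[R]_(k, m)) (C : 'M[R]_(p, k)) (s : R[i]) :=
  mxC C *m invmx (s%:M - mxC A) *m mxC B.

Section Fixed.
Variables (k m p : nat) (A : 'M[R]_k) (B : 'M[R]_(k, m)) (C : 'M[R]_(p, k)).
Hypothesis stA : stable A.

(** Let X be the inverse of P. A Schur complement in the first inequality says that
    g X solves the Lyapunov equation for some right-hand side above B B^T, so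
    g X dominates the Gramian. A Schur complement in the second gives
    G >= C X C^T. Hence the squared norm is at most g tr (C X C^T) <= g^2. *)
Lemma h2_lmi_sound (g : R) (P : 'M[R]_k) (G : 'M[R]_p) : 0 < g -> posdef P ->
  h2_lmi A B C g P G -> h2norm (transfer A B C) <= g.
Proof.
move=> g0 Pp [lmi1 lmi2 trG].
have Pu := posdef_unitmx Pp; set X := invmx P.
have Xs : X^T = X by exact: trmx_inv_sym Pp.1.
have g_neq0 : g != 0 by rewrite gt_eqF.
pose S := - (g *: (A *m X + X *m A^T) + B *m B^T).
have S_psd : psd S.
  (* The column (X, g^-1 B^T) eliminates the second block: Schur complement. *)
  have := psd_congr (col_mx X (g^-1 *: B^T)) lmi1 => /(psdZ (ltW g0)).
  rewrite mulmxN mulNmx tr_col_mx Xs linearZ /= trmxK mul_row_block.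
  have -> : X *m (P *m B) + g^-1 *: B *m (- g%:M) = 0.
    rewrite mulKmx // mulmxN mul_mx_scalar scalerA mulfV // scale1r.
    by rewrite subrr.
  rewrite mul_row_col mul0mx addr0 mulmxDl mulmxDr !mulmxA [X *m P]mulVmx // mul1mx.
  rewrite mulmxDl -!mulmxA mulmxV // !mulmx1 -scalemxAl.
  by rewrite scalerN scalerDr scalerA mulfV // scale1r /S [X *m A^T + _]addrC.
have [L0 L0eq] := lyapunov_solvable stA (B *m B^T).
have diff_eq : A *m (g *: X - L0) + (g *: X - L0) *m A^T = - S.
  rewrite mulmxBr mulmxBl addrACA -opprD L0eq -scalemxAr -scalemxAl -scalerDr.
  by rewrite /S !opprK.
have diff_psd := lyapunov_psd stA S_psd diff_eq.
have G_ge : psd (G - C *m X *m C^T).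
  (* Schur complement with respect to P. *)
  have := psd_congr (col_mx (- (X *m C^T)) 1%:M) lmi2.
  have E : (- (X *m C^T))^T = - (C *m X) by rewrite linearN /= trmx_mul trmxK Xs.
  rewrite tr_col_mx E mul_row_block mul_row_col trmx1 !mul1mx mulmx1 !mulNmx.
  by rewrite -[C *m X *m P]mulmxA mulVmx // mulmx1 addNr mul0mx add0r addrC.
rewrite /transfer (h2norm_gramian stA C L0eq).
suff le_g2 : \tr (C *m L0 *m C^T) <= g ^+ 2.
  by apply: le_trans (ler_wsqrtr le_g2) _; rewrite sqrtr_sqr ger0_norm // ltW.
rewrite expr2.
have trL : 0 <= \tr (C *m (g *: X - L0) *m C^T).
  by have := psd_trace_ge0 (psd_congr C^T diff_psd); rewrite trmxK.
have trG' := psd_trace_ge0 G_ge.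
move: trL trG'; rewrite mulmxBr mulmxBl -scalemxAr -scalemxAl !raddfB /= mxtraceZ.
rewrite !subr_ge0 => h1 h2; apply: le_trans h1 _.
by apply: ler_wpM2l; [exact: ltW|exact: le_trans h2 trG].
Qed.

Lemma h2norm_ge0 : 0 <= h2norm (transfer A B C).
Proof. exact: sqrtr_ge0. Qed.

(** The negated block matrix is a positive combination of two Gram matrices (completion of the
    square). *)
Lemma lyapunov_nsd (g e : R) (P X : 'M[R]_k) : 0 < g -> 0 < e ->
  P^T = P -> P *m X = 1%:M ->
  A *m X + X *m A^T = - g^-1 *: (B *m B^T + e *: 1%:M) ->
  nsd (block_mx (A^T *m P + P *m A) (P *m B) (B^T *m P) (- g%:M)).
Proof.
move=> g0 e0 Ps PX Xeq; have XP := mulmx1C PX.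
have g_neq0 : g != 0 by rewrite gt_eqF.
rewrite /nsd.
pose T1 : 'M[R]_(k, k + m) := row_mx P 0.
pose T2 : 'M[R]_(m, k + m) := row_mx (- (g^-1 *: (B^T *m P))) 1%:M.
rewrite (_ : - _ = (g^-1 * e) *: (T1^T *m T1) + g *: (T2^T *m T2)).
  apply: psdD; apply: psdZ; try exact: psd_mxgram; last exact: ltW.
  by rewrite ltW // mulr_gt0 ?invr_gt0.
have Lyap : A^T *m P + P *m A = - g^-1 *: (P *m (B *m B^T) *m P + e *: (P *m P)).
  have -> : A^T *m P + P *m A = P *m (A *m X + X *m A^T) *m P.
    rewrite mulmxDr mulmxDl !mulmxA PX mul1mx addrC.
    by rewrite -[P *m A *m X *m P]mulmxA XP mulmx1.
  by rewrite Xeq -scalemxAr -scalemxAl mulmxDr mulmxDl -scalemxAr -scalemxAl mulmx1.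
rewrite /T1 /T2 !tr_row_mx !mul_col_row Lyap !trmx0 !mul0mx !mulmx0 trmx1 !mul1mx mulmx1.
have -> : (- (g^-1 *: (B^T *m P)))^T = - (g^-1 *: (P *m B)).
  by rewrite linearN /= linearZ /= trmx_mul trmxK Ps.
rewrite Ps opp_block_mx !scale_block_mx add_block_mx !scaler0 !add0r.
congr block_mx.
- rewrite mulNmx mulmxN opprK -scalemxAl -scalemxAr !scalerA mulfV // mul1r !mulmxA.
  by rewrite scaleNr opprK scalerDr scalerA addrC.
- by rewrite scalerN scalerA mulfV // scale1r.
- by rewrite scalerN scalerA mulfV // scale1r.
- by rewrite opprK scalemx1.
Qed.

(** For small e > 0 the matrix L1 - e I still solves a Lyapunov equation with a
    positive semidefinite right-hand side, so L1 >= e I. *)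
Lemma lyapunov_posdef (L1 : 'M[R]_k) : A *m L1 + L1 *m A^T = - 1%:M -> posdef L1.
Proof.
move=> L1eq.
(* Small enough for 1 + e (A + A^T) to stay positive, by [quad_form_bound]. *)
pose e := (1 + \sum_i \sum_j `|(A + A^T) i j|)^-1.
have e0 : 0 < e.
  by rewrite invr_gt0 ltr_pwDl // sumr_ge0 // => i _; rewrite sumr_ge0.
suff h : psd (L1 - e *: 1%:M).
  rewrite -[L1](subrK (e *: 1%:M)) addrC; apply: posdefD => //.
  by apply: posdefZ => //; exact: posdef1.
apply: (@lyapunov_psd _ _ A stA _ (1%:M + e *: (A + A^T))); last first.
  rewrite mulmxBr mulmxBl addrACA -opprD L1eq -scalemxAr -scalemxAl mulmx1 mul1mx.
  by rewrite scalerDr !opprD.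
split=> [|x]; first by rewrite linearD linearZ /= trmx1 linearD /= trmxK [A^T + A]addrC.
rewrite mulmxDr mulmxDl mulmx1 -scalemxAr -scalemxAl.
have mxDZ (a : R) (U V' : 'M[R]_1) : (U + a *: V') 0 0 = U 0 0 + a * V' 0 0.
  by rewrite !mxE.
rewrite mxDZ; have := quad_form_bound (A + A^T) x; set t := (_ *m _ *m _) 0 0.
set c := \sum_i _ in e e0 *; set d := (x^T *m x) 0 0.
have d0 : 0 <= d by exact: dot_ge0.
have c0 : 0 <= c by apply: sumr_ge0 => i _; apply: sumr_ge0.
rewrite ler_norml => /andP[tl _].
have : e * (- (c * d)) <= e * t by rewrite ler_wpM2l // ltW.
have ec : e * (1 + c) = 1 by rewrite /e mulVf // gt_eqF // ltr_pwDl.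
have : e * d >= 0 by rewrite mulr_ge0 // ltW.
have : d = e * (1 + c) * d by rewrite ec mul1r.
nra.
Qed.

(** The Gramian L0 may be singular, so a small multiple of the solution L1 of the
    equation with right-hand side I is added before inverting; the gap between
    the norm and [g] pays for it. *)
Lemma h2_lmi_complete (g : R) : h2norm (transfer A B C) < g ->
  exists (P : 'M[R]_k) (G : 'M[R]_p), posdef P /\ h2_lmi A B C g P G.
Proof.
move=> Jg; have g0 := le_lt_trans h2norm_ge0 Jg; have g_neq0 : g != 0 by rewrite gt_eqF.
have [L0 L0eq] := lyapunov_solvable stA (B *m B^T).
have [L1 L1eq] := lyapunov_solvable stA 1%:M.
have L0p : psd L0.
  by apply: lyapunov_psd L0eq => //; have := psd_mxgram B^T; rewrite trmxK.
have L1p : posdef L1 by exact: lyapunov_posdef L1eq.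
pose tau := \tr (C *m L1 *m C^T).
have tau0 : 0 <= tau.
  by have := psd_trace_ge0 (psd_congr C^T (posdef_psd L1p)); rewrite trmxK.
pose h := h2norm (transfer A B C).
have hE : h ^+ 2 = \tr (C *m L0 *m C^T).
  rewrite /h (h2norm_gramian stA C L0eq) sqr_sqrtr //.
  by have := psd_trace_ge0 (psd_congr C^T L0p); rewrite trmxK.
have h0 : 0 <= h by exact: h2norm_ge0.
(* Chosen so that e * tau <= g ^+ 2 - h ^+ 2. *)
pose e := (g ^+ 2 - h ^+ 2) / (1 + tau).
have gh : 0 < g ^+ 2 - h ^+ 2 by rewrite subr_gt0 ltr_pXn2r // ?nnegrE ltW.
have e0 : 0 < e by rewrite divr_gt0 // ltr_pwDl.
pose L := L0 + e *: L1.
have Lp : posdef L by rewrite /L addrC; apply: posdefD => //; exact: posdefZ.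
have Leq : A *m L + L *m A^T = - (B *m B^T + e *: 1%:M).
  rewrite /L mulmxDr mulmxDl addrACA L0eq -scalemxAr -scalemxAl -scalerDr L1eq.
  by rewrite scalerN opprD.
have trL : \tr (C *m L *m C^T) <= g ^+ 2.
  rewrite /L mulmxDr mulmxDl -scalemxAr -scalemxAl raddfD /= mxtraceZ -hE -/tau.
  rewrite -lerBrDl /e -mulrA; apply: ler_piMr; first exact: ltW.
  by rewrite mulrC ler_pdivrMr ?mul1r ?lerDr // ltr_pwDl.
have Lu := posdef_unitmx Lp.
pose X := g^-1 *: L; pose P := g *: invmx L.
have Xeq : A *m X + X *m A^T = - g^-1 *: (B *m B^T + e *: 1%:M).
  by rewrite /X -scalemxAr -scalemxAl -scalerDr Leq scalerN scaleNr.
have Pp : posdef P by apply: posdefZ => //; exact: posdef_inv.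
have PX : P *m X = 1%:M.
  by rewrite /P /X -scalemxAl -scalemxAr scalerA mulfV // scale1r mulVmx.
have XP : X *m P = 1%:M by exact: mulmx1C.
have Xs : X^T = X by rewrite /X linearZ /= Lp.1.
exists P, (C *m X *m C^T); split=> //; split.
- exact: lyapunov_nsd g0 e0 Pp.1 PX Xeq.
- pose T : 'M[R]_(k, k + p) := row_mx 1%:M (X *m C^T).
  have := psd_congr T (posdef_psd Pp).
  rewrite tr_row_mx trmx1 trmx_mul trmxK Xs mul_col_mx mul1mx mul_col_row mulmx1.
  by rewrite -[C *m X *m P]mulmxA XP !mulmx1 mulmxA PX mul1mx mulmxA.
- by rewrite /X -scalemxAr -scalemxAl mxtraceZ ler_pdivrMl // -expr2.
Qed.
End Fixed.
End H2LMI.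

(** * The convex lifting *)

Lemma addr3_sub3 (U : zmodType) (a b c d : U) : a + b + c + d - a - b - c = d.
Proof.
rewrite (_ : _ - c = a + b + c + d - (a + b + c)); last by rewrite !opprD !addrA.
by rewrite addrC addKr.
Qed.

Lemma add3_sub3 (U : zmodType) (a b c d : U) : a + b + c + (d - a - b - c) = d.
Proof.
rewrite (_ : d - _ - _ - _ = d - (a + b + c)); last by rewrite !opprD !addrA.
by rewrite addrC subrK.
Qed.

Section Mixture.
Variables (R : realType).

Definition mix (t : R) k l (M N : 'M[R]_(k, l)) : 'M[R]_(k, l) :=
  (1 - t) *: M + t *: N.

Variable t : R.

Lemma mix_id k l (M : 'M[R]_(k, l)) : mix t M M = M.
Proof. by rewrite /mix -scalerDl subrK scale1r. Qed.

Lemma mix0 k l (M N : 'M[R]_(k, l)) : mix 0 M N = M.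
Proof. by rewrite /mix subr0 scale1r scale0r addr0. Qed.

Lemma mixD k l (M N M' N' : 'M[R]_(k, l)) :
  mix t (M + M') (N + N') = mix t M N + mix t M' N'.
Proof. by rewrite /mix !scalerDr addrACA. Qed.

Lemma mixN k l (M N : 'M[R]_(k, l)) : mix t (- M) (- N) = - mix t M N.
Proof. by rewrite /mix !scalerN opprD. Qed.

Lemma mix_mull h k l (T : 'M[R]_(h, k)) (M N : 'M[R]_(k, l)) :
  mix t (T *m M) (T *m N) = T *m mix t M N.
Proof. by rewrite /mix mulmxDr -!scalemxAr. Qed.

Lemma mix_mulr h k l (M N : 'M[R]_(h, k)) (T : 'M[R]_(k, l)) :
  mix t (M *m T) (N *m T) = mix t M N *m T.
Proof. by rewrite /mix mulmxDl -!scalemxAl. Qed.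

Lemma mix_tr k l (M N : 'M[R]_(k, l)) : mix t M^T N^T = (mix t M N)^T.
Proof. by rewrite /mix linearD /= !linearZ. Qed.

Lemma mix_scalar k (a b : R) :
  mix t a%:M b%:M = ((1 - t) * a + t * b)%:M :> 'M[R]_k.
Proof. by rewrite /mix !scale_scalar_mx -raddfD. Qed.

Lemma mix_block k1 k2 l1 l2 (M1 N1 : 'M[R]_(k1, l1)) (M2 N2 : 'M[R]_(k1, l2))
    (M3 N3 : 'M[R]_(k2, l1)) (M4 N4 : 'M[R]_(k2, l2)) :
  mix t (block_mx M1 M2 M3 M4) (block_mx N1 N2 N3 N4) =
  block_mx (mix t M1 N1) (mix t M2 N2) (mix t M3 N3) (mix t M4 N4).
Proof. by rewrite /mix !scale_block_mx add_block_mx. Qed.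

Lemma mix_trace k (M N : 'M[R]_k) :
  \tr (mix t M N) = (1 - t) * \tr M + t * \tr N.
Proof. by rewrite /mix raddfD /= !mxtraceZ. Qed.

Hypotheses (t_ge0 : 0 <= t).

Lemma psd_mix k (M N : 'M[R]_k) : t <= 1 -> psd M -> psd N -> psd (mix t M N).
Proof. by move=> t1 Mp Np; apply: psdD; apply: psdZ; rewrite ?subr_ge0. Qed.

Lemma posdef_mix k (M N : 'M[R]_k) : t < 1 -> posdef M -> psd N -> posdef (mix t M N).
Proof.
by move=> t1 Mp Np; apply: posdefD; [apply: posdefZ|apply: psdZ]; rewrite ?subr_gt0.
Qed.

End Mixture.

Section Lifting.
Variables (R : realType) (n m p : nat).
Variables (A : 'M[R]_n) (B : 'M[R]_(n, m)) (C : 'M[R]_(p, n)).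
Variables (Q W : 'M[R]_n) (Rw : 'M[R]_m) (V : 'M[R]_p).
Implicit Types (X Y M N Ah : 'M[R]_n) (Bh : 'M[R]_(n, p)) (Ch : 'M[R]_(m, n)).
Implicit Types (K : policy R n m p).

(** Up to congruence, [liftA], [liftB], [liftC] and [liftP] are P Acl, P Bcl, Ccl and
    P; see [basis_Acl], [basis_Bcl], [basis_Ccl] and [lift_certificate]. All of
    them are affine in (X, Y, Ah, Bh, Ch), where X and Y are the upper left
    blocks of P and of its inverse. *)
Definition liftA X Y Ah Bh Ch : 'M[R]_(n + n) :=
  block_mx (A *m Y + B *m Ch) A Ah (X *m A + Bh *m C).
Definition liftB X Bh : 'M[R]_(n + n, n + p) :=
  block_mx (sqrtmx W) 0 (X *m sqrtmx W) (Bh *m sqrtmx V).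
Definition liftC Y Ch : 'M[R]_(n + m, n + n) :=
  block_mx (sqrtmx Q *m Y) (sqrtmx Q) (sqrtmx Rw *m Ch) 0.
Definition liftP X Y : 'M[R]_(n + n) := block_mx Y 1%:M 1%:M X.

Definition lifted_lmi X Y Ah Bh Ch (g : R) (G : 'M[R]_(n + m)) : Prop :=
  [/\ nsd (block_mx ((liftA X Y Ah Bh Ch)^T + liftA X Y Ah Bh Ch)
              (liftB X Bh) (liftB X Bh)^T (- g%:M)),
      psd (block_mx (liftP X Y) (liftC Y Ch)^T (liftC Y Ch) G) & \tr G <= g].

(** All blocks are affine, and semidefinite matrices form a convex cone. *)
Lemma lifted_lmi_mix (t : R) X Y Ah Bh Ch g G X' Y' Ah' Bh' Ch' g' G' :
  0 <= t <= 1 -> lifted_lmi X Y Ah Bh Ch g G -> lifted_lmi X' Y' Ah' Bh' Ch' g' G' ->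
  lifted_lmi (mix t X X') (mix t Y Y') (mix t Ah Ah') (mix t Bh Bh') (mix t Ch Ch')
    ((1 - t) * g + t * g') (mix t G G').
Proof.
move=> /andP[t0 t1] [a1 a2 a3] [b1 b2 b3].
have EA : mix t (liftA X Y Ah Bh Ch) (liftA X' Y' Ah' Bh' Ch') =
    liftA (mix t X X') (mix t Y Y') (mix t Ah Ah') (mix t Bh Bh') (mix t Ch Ch').
  by rewrite /liftA mix_block !mixD !mix_mull !mix_mulr mix_id.
have EB : mix t (liftB X Bh) (liftB X' Bh') = liftB (mix t X X') (mix t Bh Bh').
  by rewrite /liftB mix_block !mix_mulr !mix_id.
have EC : mix t (liftC Y Ch) (liftC Y' Ch') = liftC (mix t Y Y') (mix t Ch Ch').
  by rewrite /liftC mix_block !mix_mull !mix_id.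
have EP : mix t (liftP X Y) (liftP X' Y') = liftP (mix t X X') (mix t Y Y').
  by rewrite /liftP mix_block !mix_id.
split.
- rewrite -EA -EB -!mix_tr -mixD -mix_scalar -mixN -mix_block /nsd -mixN.
  exact: psd_mix.
- by rewrite -EC -EP -!mix_tr -mix_block; exact: psd_mix.
- rewrite mix_trace; apply: lerD; apply: ler_wpM2l => //.
  by rewrite subr_ge0.
Qed.

(** The congruence is by [basis1]. With N and M the upper right blocks of P and of
    its inverse, P maps [basis1] to [basis2], and this removes the products
    between P and the policy. *)
Definition basis1 Y M : 'M[R]_(n + n) := block_mx Y 1%:M M^T 0.
Definition basis2 X N : 'M[R]_(n + n) := block_mx 1%:M X 0 N^T.

(** The new variable Ah. The other two are N BK for Bh and CK M^T for Ch. *)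
Definition encodeA K X Y M N : 'M[R]_n :=
  X *m A *m Y + N *m polB K *m C *m Y + X *m B *m polC K *m M^T + N *m polA K *m M^T.

Section Congruence.
Variables (K : policy R n m p) (X Y M N : 'M[R]_n).
Hypothesis (X_sym : X^T = X).
Let Ah := encodeA K X Y M N.
Let Bh := N *m polB K.
Let Ch := polC K *m M^T.

Lemma basis_Acl : (basis2 X N)^T *m Acl A B C K *m basis1 Y M = liftA X Y Ah Bh Ch.
Proof.
rewrite /basis2 /Acl /basis1 tr_block_mx trmxK trmx1 trmx0 X_sym !mulmx_block.
rewrite !mul1mx !mul0mx !addr0 !mulmx0 !mulmx1 !addr0 /liftA; congr block_mx.
- by rewrite mulmxA.
- by rewrite mulmxDl mulmxDl !mulmxA /Ah /encodeA !addrA.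
- by rewrite mulmxA.
Qed.

Lemma basis_Bcl : (basis2 X N)^T *m Bcl W V K = liftB X Bh.
Proof.
rewrite /basis2 /Bcl tr_block_mx trmxK trmx1 trmx0 X_sym !mulmx_block.
by rewrite !mul1mx !mul0mx !addr0 !mulmx0 !addr0 add0r mulmxA.
Qed.

Lemma basis_Ccl : Ccl Q Rw K *m basis1 Y M = liftC Y Ch.
Proof.
rewrite /basis1 /Ccl !mulmx_block.
by rewrite !mul0mx !addr0 !mulmx1 !mulmx0 !add0r ?addr0 /liftC /Ch mulmxA.
Qed.

Lemma congr_block k l (U : 'M[R]_k) (S : 'M[R]_(k, l)) (Z : 'M[R]_l) (E : 'M[R]_k) :
  let T := block_mx E 0 0 1%:M in
  T^T *m block_mx U S S^T Z *m T = block_mx (E^T *m U *m E) (E^T *m S) (S^T *m E) Z.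
Proof.
rewrite /= tr_block_mx !trmx0 trmx1 !mulmx_block.
by rewrite !mul0mx !mulmx0 !mul1mx !mulmx1 !addr0 !add0r.
Qed.

Variable P : 'M[R]_(n + n).
Hypotheses (P_sym : P^T = P) (P_basis : P *m basis1 Y M = basis2 X N).
Hypothesis (P_lift : (basis1 Y M)^T *m basis2 X N = liftP X Y).

Lemma lifted_gain_congr (g : R) (T := block_mx (basis1 Y M) 0 0 1%:M) :
  block_mx ((liftA X Y Ah Bh Ch)^T + liftA X Y Ah Bh Ch)
              (liftB X Bh) (liftB X Bh)^T (- g%:M) =
  T^T *m block_mx ((Acl A B C K)^T *m P + P *m Acl A B C K) (P *m Bcl W V K)
                      ((Bcl W V K)^T *m P) (- g%:M) *m T.
Proof.
have -> : (Bcl W V K)^T *m P = (P *m Bcl W V K)^T by rewrite trmx_mul P_sym.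
have P_basisT : (basis1 Y M)^T *m P = (basis2 X N)^T.
  by rewrite -P_basis trmx_mul P_sym.
have E1 : (basis1 Y M)^T *m (P *m Bcl W V K) = liftB X Bh.
  by rewrite mulmxA P_basisT basis_Bcl.
have E2 : (basis1 Y M)^T *m (P *m Acl A B C K) *m basis1 Y M = liftA X Y Ah Bh Ch.
  by rewrite mulmxA P_basisT basis_Acl.
have E3 : (basis1 Y M)^T *m ((Acl A B C K)^T *m P) *m basis1 Y M =
    (liftA X Y Ah Bh Ch)^T.
  by rewrite -E2 !trmx_mul P_sym trmxK !mulmxA.
rewrite congr_block mulmxDr mulmxDl E3 E2 E1 -E1.
by congr block_mx; rewrite [LHS]trmx_mul trmxK.
Qed.

Lemma lifted_trace_congr (G : 'M[R]_(n + m)) (T := block_mx (basis1 Y M) 0 0 1%:M) :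
  block_mx (liftP X Y) (liftC Y Ch)^T (liftC Y Ch) G =
  T^T *m block_mx P (Ccl Q Rw K)^T (Ccl Q Rw K) G *m T.
Proof.
have := congr_block P (Ccl Q Rw K)^T G (basis1 Y M); rewrite /= trmxK => ->.
by rewrite -basis_Ccl trmx_mul -mulmxA P_basis P_lift.
Qed.

End Congruence.

Lemma basis1_unit Y M : M \in unitmx -> basis1 Y M \in unitmx.
Proof.
rewrite -unitmx_tr => MTu.
apply: unitmx_col_inj => x;
  rewrite -[x]vsubmxK /basis1 mul_block_col mul1mx mul0mx addr0.
rewrite -(col_mx0 _ n n 1) => /eq_col_mx[e1 e2].
have u0 : usubmx x = 0 by rewrite -(mulKmx MTu (usubmx x)) e2 mulmx0.
by move: e1; rewrite u0 mulmx0 add0r => ->.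
Qed.

Lemma lift_certificate K (P : 'M[R]_(n + n)) (g : R) (G : 'M[R]_(n + m)) :
  posdef P -> h2_lmi (Acl A B C K) (Bcl W V K) (Ccl Q Rw K) g P G ->
  let X := ulsubmx P in let N := ursubmx P in
  let Y := ulsubmx (invmx P) in let M := ursubmx (invmx P) in
  [/\ X^T = X, Y^T = Y, X *m Y + N *m M^T = 1%:M & N^T *m Y + drsubmx P *m M^T = 0] /\
  liftP X Y = (basis1 Y M)^T *m P *m basis1 Y M /\
  lifted_lmi X Y (encodeA K X Y M N) (N *m polB K) (polC K *m M^T) g G.
Proof.
move=> Pp [lmi1 lmi2 trG] X N Y M.
have Pu := posdef_unitmx Pp; have Ps := Pp.1; have Pis := trmx_inv_sym Ps.
have PE : P = block_mx X N N^T (drsubmx P).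
  by rewrite /X /N trmx_ursub Ps submxK.
have PiE : invmx P = block_mx Y M M^T (drsubmx (invmx P)).
  by rewrite /Y /M trmx_ursub Pis submxK.
have Xs : X^T = X by rewrite /X trmx_ulsub Ps.
have Ys : Y^T = Y by rewrite /Y trmx_ulsub Pis.
have := mulmxV Pu; rewrite {1}PE PiE mulmx_block scalar_mx_block.
move=> /eq_block_mx[XY _ NY _].
have P_basis : P *m basis1 Y M = basis2 X N.
  rewrite {1}PE /basis1 mulmx_block XY NY !mulmx1 !mulmx0 !addr0.
  by [].
have P_lift : (basis1 Y M)^T *m basis2 X N = liftP X Y.
  rewrite /basis1 /basis2 tr_block_mx mulmx_block trmxK trmx1 trmx0 Ys.
  rewrite !mulmx1 !mulmx0 !mul1mx !mul0mx !addr0 /liftP; congr block_mx.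
  have := congr1 trmx XY; rewrite linearD /= !trmx_mul trmxK Xs Ys trmx1.
  by [].
split; first by [].
split; first by rewrite -P_lift -P_basis mulmxA.
split=> //.
- by rewrite (lifted_gain_congr _ Xs Ps P_basis) /nsd -mulNmx -mulmxN; exact: psd_congr.
- by rewrite (lifted_trace_congr _ P_basis P_lift); exact: psd_congr.
Qed.

(** If (1 - X Y) x = 0 then the vector (x, - Y x) is in the kernel of [liftP]. *)
Lemma one_sub_XY_unit X Y : posdef (liftP X Y) -> 1%:M - X *m Y \in unitmx.
Proof.
move=> [_ lP]; apply: unitmx_col_inj => x.
rewrite mulmxBl mul1mx => /eqP; rewrite subr_eq0 => /eqP xE.
apply/eqP; apply: contraT => x0.
have v0 : col_mx x (- (Y *m x)) != 0.
  by apply: contraNneq x0; rewrite -(col_mx0 _ n n 1) => /eq_col_mx[-> _].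
have := lP _ v0; rewrite -mulmxA /liftP mul_block_col !mul1mx mulmxN mulmxA -xE.
by rewrite !subrr col_mx0 mulmx0 mxE ltxx.
Qed.

(** Agrees with [invmx] on invertible matrices ([adj_invmxE]), but is a single
    rational expression, so that it can be differentiated entrywise. *)
Definition adj_invmx (N : 'M[R]_n) : 'M[R]_n := (\det N)^-1 *: \adj N.

Lemma adj_invmxE N : N \in unitmx -> adj_invmx N = invmx N.
Proof. by move=> Nu; rewrite /invmx Nu. Qed.

(** The block N is forced by X Y + N M^T = 1 once M is chosen. The choice of M is
    free: it amounts to a change of coordinates of the policy state. *)
Definition decodeN M X Y : 'M[R]_n := (1%:M - X *m Y) *m (invmx M)^T.

Definition decode M X Y Ah Bh Ch : policy R n m p :=
  (adj_invmx (decodeN M X Y) *m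
     (Ah - X *m A *m Y - Bh *m C *m Y - X *m B *m Ch) *m (invmx M)^T,
   adj_invmx (decodeN M X Y) *m Bh,
   Ch *m (invmx M)^T).

Lemma decode_encode K M X Y N : M \in unitmx -> N \in unitmx ->
  X *m Y + N *m M^T = 1%:M ->
  decode M X Y (encodeA K X Y M N) (N *m polB K) (polC K *m M^T) = K.
Proof.
move=> Mu Nu XY; have MTu : M^T \in unitmx by rewrite unitmx_tr.
have NE : decodeN M X Y = N.
  by rewrite /decodeN -XY addrC addKr trmx_inv mulmxK.
rewrite /decode NE adj_invmxE // trmx_inv mulmxK // mulKmx // /encodeA.
rewrite !mulmxA addr3_sub3 !mulmxA mulmxK // mulVmx // mul1mx.
by case: K {XY NE} => [[]].
Qed.

Lemma decode_spec M X Y Ah Bh Ch (K := decode M X Y Ah Bh Ch) (N := decodeN M X Y) :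
  M \in unitmx -> N \in unitmx ->
  [/\ N *m M^T = 1%:M - X *m Y, N *m polB K = Bh, polC K *m M^T = Ch &
     encodeA K X Y M N = Ah].
Proof.
move=> Mu Nu; have MTu : M^T \in unitmx by rewrite unitmx_tr.
have E1 : N *m polB K = Bh by rewrite /K /decode /polB /= adj_invmxE // mulKVmx.
have E2 : polC K *m M^T = Ch by rewrite /K /decode /polC /= trmx_inv mulmxKV.
split=> //; first by rewrite /N /decodeN trmx_inv mulmxKV.
rewrite /encodeA E1 -[X *m B *m polC K *m M^T]mulmxA E2.
have -> : N *m polA K *m M^T = Ah - X *m A *m Y - Bh *m C *m Y - X *m B *m Ch.
  by rewrite /K /decode /polA /= adj_invmxE // trmx_inv mulmxA mulmxKV // mulKVmx.
by rewrite add3_sub3.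
Qed.

(** The matrix P is recovered from the lifted one by undoing the congruence.
    Positivity of [liftP] makes N invertible, so the decoded policy encodes back
    to the given variables. *)
Lemma decode_certificate M X Y Ah Bh Ch (g : R) (G : 'M[R]_(n + m))
    (K := decode M X Y Ah Bh Ch) :
  X^T = X -> Y^T = Y -> M \in unitmx -> posdef (liftP X Y) ->
  lifted_lmi X Y Ah Bh Ch g G ->
  exists P, posdef P /\ h2_lmi (Acl A B C K) (Bcl W V K) (Ccl Q Rw K) g P G.
Proof.
move=> Xs Ys Mu lPp [lmi1 lmi2 trG]; set N := decodeN M X Y.
have MTu : M^T \in unitmx by rewrite unitmx_tr.
have Nu : N \in unitmx.
  by rewrite /N /decodeN unitmx_mul one_sub_XY_unit //= unitmx_tr unitmx_inv.
have [NM EB EC EA] := decode_spec Ah Bh Ch Mu Nu; rewrite -/K -/N in NM EB EC EA.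
have Eu := basis1_unit Y Mu.
pose P := (invmx (basis1 Y M))^T *m liftP X Y *m invmx (basis1 Y M).
have Pp : posdef P by apply: posdef_congr; rewrite ?unitmx_inv.
have P_lift : (basis1 Y M)^T *m basis2 X N = liftP X Y.
  rewrite /basis1 /basis2 tr_block_mx mulmx_block trmxK trmx1 trmx0 Ys.
  rewrite !mulmx1 !mulmx0 !mul1mx !mul0mx !addr0 /liftP; congr block_mx.
  have := congr1 trmx NM; rewrite linearB /= !trmx_mul trmxK Xs Ys trmx1 => ->.
  by rewrite addrC subrK.
have P_basis : P *m basis1 Y M = basis2 X N.
  by rewrite /P mulmxKV // -P_lift mulmxA -trmx_mul mulmxV // trmx1 mul1mx.
have Tu q : block_mx (basis1 Y M) 0 0 (1%:M : 'M[R]_q) \in unitmx.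
  by rewrite unitmxE det_ublock det1 mulr1 -unitmxE.
exists P; split=> //; split=> //.
- apply: (psd_congr_unit (Tu _)); move: lmi1; rewrite /nsd mulmxN mulNmx.
  by rewrite -(lifted_gain_congr _ Xs Pp.1 P_basis) EA EB EC.
- apply: (psd_congr_unit (Tu _)); move: lmi2.
  by rewrite -(lifted_trace_congr _ P_basis P_lift) EC.
Qed.

End Lifting.

(** * Differentiable curves of policies *)

Section MatrixCurves.
Variable R : realType.
Implicit Types f g : R -> R.

Definition derivable0 f := derivable f (0 : R) (1 : R).

Lemma derivable0_cst (a : R) : derivable0 (fun=> a).
Proof. exact: derivable_cst. Qed.
Lemma derivable0D f g : derivable0 f -> derivable0 g -> derivable0 (fun t => f t + g t).
Proof. exact: derivableD. Qed.
Lemma derivable0N f : derivable0 f -> derivable0 (fun t => - f t).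
Proof. exact: derivableN. Qed.
Lemma derivable0M f g : derivable0 f -> derivable0 g -> derivable0 (fun t => f t * g t).
Proof. exact: derivableM. Qed.
Lemma derivable0V f : f 0 != 0 -> derivable0 f -> derivable0 (fun t => (f t)^-1).
Proof. by move=> f0 df; exact: derivableV. Qed.

Lemma eq_derivable0 f g : f =1 g -> derivable0 f -> derivable0 g.
Proof. by move=> /funext ->. Qed.

Lemma derivable0_sum (I : Type) (r : seq I) (F : I -> R -> R) :
  (forall i, derivable0 (F i)) -> derivable0 (fun t => \sum_(i <- r) F i t).
Proof.
move=> dF; elim: r => [|i r IH].
  rewrite (_ : (fun t => _) = (fun=> 0)); first exact: derivable0_cst.
  by apply/funext => t; rewrite big_nil.
apply: (eq_derivable0 (f :=
  fun t => F i t + \sum_(j <- r) F j t)) (derivable0D (dF i) IH) => t.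
by rewrite big_cons.
Qed.

Lemma derivable0_prod (I : Type) (r : seq I) (F : I -> R -> R) :
  (forall i, derivable0 (F i)) -> derivable0 (fun t => \prod_(i <- r) F i t).
Proof.
move=> dF; elim: r => [|i r IH].
  rewrite (_ : (fun t => _) = (fun=> 1)); first exact: derivable0_cst.
  by apply/funext => t; rewrite big_nil.
apply: (eq_derivable0 (f :=
  fun t => F i t * \prod_(j <- r) F j t)) (derivable0M (dF i) IH) => t.
by rewrite big_cons.
Qed.

Definition mx_derivable0 k l (F : R -> 'M[R]_(k, l)) :=
  forall i j, derivable0 (fun t => F t i j).

Lemma mx_derivable0_cst k l (M : 'M[R]_(k, l)) : mx_derivable0 (fun=> M).
Proof. by move=> i j; exact: derivable0_cst. Qed.

Lemma mx_derivable0D k l (F G : R -> 'M[R]_(k, l)) : mx_derivable0 F ->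
  mx_derivable0 G -> mx_derivable0 (fun t => F t + G t).
Proof.
by move=> dF dG i j; apply: eq_derivable0 (derivable0D (dF i j) (dG i j)) => t; rewrite mxE.
Qed.

Lemma mx_derivable0N k l (F : R -> 'M[R]_(k, l)) : mx_derivable0 F ->
  mx_derivable0 (fun t => - F t).
Proof. by move=> dF i j; apply: eq_derivable0 (derivable0N (dF i j)) => t;
  rewrite mxE. Qed.

Lemma mx_derivable0M h k l (F : R -> 'M[R]_(h, k)) (G : R -> 'M[R]_(k, l)) :
  mx_derivable0 F -> mx_derivable0 G -> mx_derivable0 (fun t => F t *m G t).
Proof.
move=> dF dG i j; apply: (@eq_derivable0 (fun t => \sum_s F t i s * G t s j)) => [t|].
  by rewrite mxE.
by apply: derivable0_sum => s; exact: derivable0M.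
Qed.

Lemma mx_derivable0Z k l f (F : R -> 'M[R]_(k, l)) : derivable0 f ->
  mx_derivable0 F -> mx_derivable0 (fun t => f t *: F t).
Proof. by move=> df dF i j; apply: eq_derivable0 (derivable0M df (dF i j)) => t;
  rewrite mxE. Qed.

Lemma mx_derivable0_tr k l (F : R -> 'M[R]_(k, l)) : mx_derivable0 F ->
  mx_derivable0 (fun t => (F t)^T).
Proof. by move=> dF i j; apply: eq_derivable0 (dF j i) => t; rewrite mxE. Qed.

Lemma mx_derivable0_mix k l (M N : 'M[R]_(k, l)) : mx_derivable0 (fun t => mix t M N).
Proof.
have d_id : derivable0 (fun t => t) by exact: derivable_id.
rewrite /mix; apply: mx_derivable0D.
  by apply: mx_derivable0Z; [apply: derivable0D;
    [exact: derivable0_cst|exact: derivable0N]|exact: mx_derivable0_cst].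
by apply: mx_derivable0Z; [|exact: mx_derivable0_cst].
Qed.

Lemma mx_derivable0_block k1 k2 l1 l2 (F1 : R -> 'M[R]_(k1, l1))
    (F2 : R -> 'M[R]_(k1, l2))
    (F3 : R -> 'M[R]_(k2, l1)) (F4 : R -> 'M[R]_(k2, l2)) :
  mx_derivable0 F1 -> mx_derivable0 F2 -> mx_derivable0 F3 -> mx_derivable0 F4 ->
  mx_derivable0 (fun t => block_mx (F1 t) (F2 t) (F3 t) (F4 t)).
Proof.
move=> d1 d2 d3 d4 i j.
case: (split_ordP i) => i' ->; case: (split_ordP j) => j' ->.
- by apply: eq_derivable0 (d1 i' j') => t; rewrite block_mxEul.
- by apply: eq_derivable0 (d2 i' j') => t; rewrite block_mxEur.
- by apply: eq_derivable0 (d3 i' j') => t; rewrite block_mxEdl.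
- by apply: eq_derivable0 (d4 i' j') => t; rewrite block_mxEdr.
Qed.

Lemma derivable0_det k (F : R -> 'M[R]_k) : mx_derivable0 F ->
  derivable0 (fun t => \det (F t)).
Proof.
move=> dF; apply: derivable0_sum => s; apply: derivable0M; first exact: derivable0_cst.
by apply: derivable0_prod => i; exact: dF.
Qed.

Lemma mx_derivable0_adj_invmx k (F : R -> 'M[R]_k) : F 0 \in unitmx ->
  mx_derivable0 F ->
  mx_derivable0 (fun t => adj_invmx (F t)).
Proof.
move=> F0 dF; apply: mx_derivable0Z.
  by apply: derivable0V; [rewrite -unitfE -unitmxE|exact: derivable0_det].
move=> i j; apply: (@eq_derivable0 (fun t => cofactor (F t) j i)) => [t|];
  first by rewrite mxE.
apply: derivable0M; first exact: derivable0_cst.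
apply: derivable0_det => a b; apply: eq_derivable0 (dF (lift j a) (lift i b)) => t.
by rewrite !mxE.
Qed.

Lemma derivable0_continuous f : derivable0 f -> f t @[t --> (0 : R)] --> f 0.
Proof.
by move=> df; apply: differentiable_continuous; exact/derivable1_diffP.
Qed.

(** A strict Lyapunov inequality certifies stability and survives small
    perturbations of the matrix. *)
Lemma stable_near k (F : R -> 'M[R]_k) : mx_derivable0 F -> stable (F 0) ->
  \forall t \near (0 : R), stable (F t).
Proof.
move=> dF st0; have [L Leq] := lyapunov_solvable st0 1%:M.
have Lp := lyapunov_posdef st0 Leq.
pose E t := F t *m L + L *m (F t)^T.
have dE : mx_derivable0 E.
  apply: mx_derivable0D; first by apply: mx_derivable0M => //; exact: mx_derivable0_cst.
  by apply: mx_derivable0M; [exact: mx_derivable0_cst|exact: mx_derivable0_tr].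
pose s t := \sum_i \sum_j `|E t i j - E 0 i j|.
have s0 : s 0 = 0.
  by rewrite /s big1 // => i _; rewrite big1 // => j _; rewrite subrr normr0.
have cs : s t @[t --> (0 : R)] --> s 0.
  apply: cvg_big => [|i _]; first by move=> a; exact: add_continuous.
  apply: cvg_big => [|j _]; first by move=> a; exact: add_continuous.
  apply: cvg_norm; apply: cvgB; last exact: cvg_cst.
  exact: derivable0_continuous (dE i j).
near=> t.
apply: (lyapunov_stable Lp).
split.
  by rewrite linearN linearD /= !trmx_mul trmxK Lp.1 addrC.
move=> x x0.
have st : s t < 1.
  by near: t; apply: (cvgr_lt _ cs); rewrite s0 ltr01.
have b := quad_form_bound (E t - E 0) x.
have -> : - (F t *m L + L *m (F t)^T) = 1%:M - (E t - E 0).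
  have E0 : E 0 = - 1%:M := Leq.
  rewrite -/(E t) E0; move: (E t) => Z.
  by rewrite opprK opprD addrCA subrr addr0.
have d_gt0 := dot_gt0 x0.
rewrite mulmxBr mulmxBl mulmx1; set q := x^T *m (E t - E 0) *m x in b *.
have -> : (x^T *m x - q) 0 0 = (x^T *m x) 0 0 - q 0 0 by rewrite mxE [(- q) 0 0]mxE.
rewrite subr_gt0; apply: le_lt_trans (ler_norm _) _.
apply: le_lt_trans b _; rewrite gtr_pMl //; apply: le_lt_trans st.
by apply: ler_sum => i _; apply: ler_sum => j _; rewrite !mxE.
Unshelve. all: by end_near. Qed.

End MatrixCurves.

Section Stationarity.
Variables (R : realType) (n m p : nat).

(** The differential vanishes on the coordinate directions, which span. *)
Lemma stationary_diff_eq0 (f : policy R n m p -> R) (K : policy R n m p) :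
  stationary f K -> forall v, 'd f K v = 0.
Proof.
move=> [df]; rewrite /gradient => -[gA gB gC] v.
have hA i j : 'd f K (delta_mx i j, 0, 0) = 0.
  by have /matrixP/(_ i j) := gA; rewrite !mxE deriveE.
have hB i j : 'd f K (0, delta_mx i j, 0) = 0.
  by have /matrixP/(_ i j) := gB; rewrite !mxE deriveE.
have hC i j : 'd f K (0, 0, delta_mx i j) = 0.
  by have /matrixP/(_ i j) := gC; rewrite !mxE deriveE.
case: v => [[a b] c].
have -> : (a, b, c) = \sum_i \sum_j a i j *: (delta_mx i j, 0, 0) +
   \sum_i \sum_j b i j *: (0, delta_mx i j, 0) +
   \sum_i \sum_j c i j *: (0, 0, delta_mx i j) :> policy R n m p.
  have eA : \sum_i \sum_j a i j *: (delta_mx i j, 0, 0) = (a, 0, 0) :> policy R n m p.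
    rewrite [in RHS](matrix_sum_delta a).
    have D (M N : 'M[R]_n) : (M + N, 0, 0) = (M, 0, 0) + (N, 0, 0) :> policy R n m p.
      by congr (_, _, _); rewrite addr0.
    rewrite (big_morph _ D (erefl _)); apply: eq_bigr => i _.
    rewrite (big_morph _ D (erefl _)); apply: eq_bigr => j _.
    by congr (_, _, _); rewrite scaler0.
  have eB : \sum_i \sum_j b i j *: (0, delta_mx i j, 0) = (0, b, 0) :> policy R n m p.
    rewrite [in RHS](matrix_sum_delta b).
    have D (M N : 'M[R]_(n, p)) : (0, M + N, 0) = (0, M, 0) + (0, N, 0) :> policy R n m p.
      by congr (_, _, _); rewrite addr0.
    rewrite (big_morph _ D (erefl _)); apply: eq_bigr => i _.
    rewrite (big_morph _ D (erefl _)); apply: eq_bigr => j _.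
    by congr (_, _, _); rewrite scaler0.
  have eC : \sum_i \sum_j c i j *: (0, 0, delta_mx i j) = (0, 0, c) :> policy R n m p.
    rewrite [in RHS](matrix_sum_delta c).
    have D (M N : 'M[R]_(m, n)) : (0, 0, M + N) = (0, 0, M) + (0, 0, N) :> policy R n m p.
      by congr (_, _, _); rewrite addr0.
    rewrite (big_morph _ D (erefl _)); apply: eq_bigr => i _.
    rewrite (big_morph _ D (erefl _)); apply: eq_bigr => j _.
    by congr (_, _, _); rewrite scaler0.
  by rewrite eA eB eC; congr (_, _, _); rewrite /= ?addr0 ?add0r.
rewrite !linearD /= !linear_sum /= !big1 ?addr0 // => i _;
  rewrite linear_sum big1 // => j _; rewrite linearZ /=.
- by rewrite hC scaler0.
- by rewrite hB scaler0.
- by rewrite hA scaler0.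
Qed.

(** By the chain rule [f] has slope 0 along the curve, while the assumption bounds
    its right-hand slope by [d]. *)
Lemma stationary_no_descent (f : policy R n m p -> R)
    (K : R -> policy R n m p) (d : R) :
  stationary f (K 0) -> mx_derivable0 (fun t => polA (K t)) ->
    mx_derivable0 (fun t => polB (K t)) ->
  mx_derivable0 (fun t => polC (K t)) ->
  (\forall t \near 0^'+, f (K t) <= f (K 0) + t * d) -> 0 <= d.
Proof.
move=> st dA dB dC desc.
have dK : differentiable K 0.
  rewrite (_ : K = fun t => (polA (K t), polB (K t), polC (K t))); last first.
    by apply/funext => t; case: (K t) => [[]].
  by do !apply: differentiable_pair; apply/derivable1_diffP/derivable_mxP.
have df := st.1.
have dfK : differentiable (f \o K) 0 by exact: differentiable_comp.
have D0 : 'D_1 (f \o K) 0 = 0.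
  by rewrite deriveE // diff_comp //= stationary_diff_eq0.
have dfK1 : derivable (f \o K) 0 (1 : R) by exact: diff_derivable.
have h0 : (fun h => h^-1 *: (((f \o K) \o shift 0) (h *: (1 : R)) - (f \o K) 0)) @ 0^'
    --> 'D_1 (f \o K) 0 := dfK1.
have h := cvg_dnbhs_at_right h0; rewrite D0 in h.
apply: cvgr_to_le h _; near=> t.
have t0 : 0 < t by near: t; exact: nbhs_right_gt.
have ft : f (K t) <= f (K 0) + t * d by near: t.
rewrite /= /GRing.scale /= mulr1 addr0 ler_pdivrMl // lerBlDl.
exact: ft.
Unshelve. all: by end_near. Qed.

End Stationarity.

Section Path.
Variables (R : realType) (n m p : nat).
Variables (A : 'M[R]_n) (B : 'M[R]_(n, m)) (C : 'M[R]_(p, n)).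

Lemma mx_derivable0_decode (M : 'M[R]_n) X Y Ah Bh Ch X' Y' Ah' Bh' Ch'
    (K := fun t => decode A B C M (mix t X X') (mix t Y Y') (mix t Ah Ah')
                     (mix t Bh Bh') (mix t Ch Ch')) :
  decodeN M X Y \in unitmx ->
  [/\ mx_derivable0 (fun t => polA (K t)), mx_derivable0 (fun t => polB (K t)) &
    mx_derivable0 (fun t => polC (K t))].
Proof.
move=> N0u.
have dN : mx_derivable0 (fun t => adj_invmx (decodeN M (mix t X X') (mix t Y Y'))).
  apply: mx_derivable0_adj_invmx; first by rewrite /mix subr0 !scale0r !scale1r !addr0.
  apply: mx_derivable0M; last exact: mx_derivable0_cst.
  apply: mx_derivable0D; first exact: mx_derivable0_cst.
  by apply: mx_derivable0N; apply: mx_derivable0M; exact: mx_derivable0_mix.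
split; last by apply: mx_derivable0M;
  [exact: mx_derivable0_mix|exact: mx_derivable0_cst].
  apply: mx_derivable0M; last exact: mx_derivable0_cst.
  apply: mx_derivable0M => //.
  apply: mx_derivable0D; last first.
    apply: mx_derivable0N; apply: mx_derivable0M; last exact: mx_derivable0_mix.
    by apply: mx_derivable0M; [exact: mx_derivable0_mix|exact: mx_derivable0_cst].
  apply: mx_derivable0D; last first.
    apply: mx_derivable0N; apply: mx_derivable0M; last exact: mx_derivable0_mix.
    by apply: mx_derivable0M; [exact: mx_derivable0_mix|exact: mx_derivable0_cst].
  apply: mx_derivable0D; first exact: mx_derivable0_mix.
  apply: mx_derivable0N; apply: mx_derivable0M; last exact: mx_derivable0_mix.
  by apply: mx_derivable0M; [exact: mx_derivable0_mix|exact: mx_derivable0_cst].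
by apply: mx_derivable0M => //; exact: mx_derivable0_mix.
Qed.

Lemma mx_derivable0_Acl (K : R -> policy R n m p) :
  mx_derivable0 (fun t => polA (K t)) -> mx_derivable0 (fun t => polB (K t)) ->
    mx_derivable0 (fun t => polC (K t)) ->
  mx_derivable0 (fun t => Acl A B C (K t)).
Proof.
move=> dA dB dC; apply: mx_derivable0_block => //; first exact: mx_derivable0_cst.
  by apply: mx_derivable0M => //; exact: mx_derivable0_cst.
by apply: mx_derivable0M => //; exact: mx_derivable0_cst.
Qed.

End Path.

(** * Stationary non-degenerate policies *)

(** The segment between the two lifted certificates, decoded with the block M of
    the first one. M is invertible: if M^T x = 0, then N^T Y x = 0 and
    x = X Y x by the two block equations of P P^-1 = 1, whence Y x = 0 and x = 0. *)
Lemma certified_path (R : realType) (n m p : nat)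
    (A : 'M[R]_n) (B : 'M[R]_(n, m)) (C : 'M[R]_(p, n))
    (Q W : 'M[R]_n) (Rw : 'M[R]_m) (V : 'M[R]_p)
    (K0 K1 : policy R n m p) (P0 P1 : 'M[R]_(n + n)) (G0 G1 : 'M[R]_(n + m))
    (g0 g1 : R) :
  posdef P0 -> ursubmx P0 \in unitmx ->
  h2_lmi (Acl A B C K0) (Bcl W V K0) (Ccl Q Rw K0) g0 P0 G0 ->
  posdef P1 -> h2_lmi (Acl A B C K1) (Bcl W V K1) (Ccl Q Rw K1) g1 P1 G1 ->
  exists K : R -> policy R n m p,
    [/\ K 0 = K0, mx_derivable0 (fun t => polA (K t)), mx_derivable0 (fun t =>
      polB (K t)) &
        mx_derivable0 (fun t => polC (K t))] /\
    forall t, 0 <= t < 1 -> exists P G, posdef P /\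
      h2_lmi (Acl A B C (K t)) (Bcl W V (K t)) (Ccl Q Rw (K t))
        ((1 - t) * g0 + t * g1) P G.
Proof.
move=> P0p Nu lmi0 P1p lmi1.
have [[Xs Ys XY NY] [lP L0]] := lift_certificate P0p lmi0.
have [[Xs' Ys' _ _] [lP' L1]] := lift_certificate P1p lmi1.
move: (ulsubmx P0) (ursubmx P0) Xs XY NY lP L0 Nu => X N Xs XY NY.
move: (ulsubmx (invmx P0)) (ursubmx (invmx P0)) Ys XY NY => Y M Ys XY NY lP L0 Nu.
move: (ulsubmx P1) Xs' lP' L1 => X' Xs'.
move: (ulsubmx (invmx P1)) Ys' => Y' Ys' lP' L1.
have Mu : M \in unitmx.
  rewrite -unitmx_tr; apply: unitmx_col_inj => x Mx.
  have Yx : Y *m x = 0.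
    have := congr1 (mulmx^~ x) NY;
      rewrite mulmxDl -!mulmxA Mx mulmx0 addr0 mul0mx => NYx.
    by rewrite -(mulKmx (_ : N^T \in unitmx) (Y *m x)) ?unitmx_tr // NYx mulmx0.
  have := congr1 (mulmx^~ x) XY; rewrite mulmxDl -!mulmxA Mx Yx !mulmx0 addr0 mul1mx.
  by [].
have lPp : posdef (liftP X Y).
  by rewrite lP; apply: posdef_congr => //; exact: basis1_unit.
have lPp' : psd (liftP X' Y') by rewrite lP'; apply: psd_congr; exact: posdef_psd.
have K0E := decode_encode A B C K0 Mu Nu XY.
move: (encodeA _ _ _ _ _ _ _ _) (N *m _) (_ *m M^T) L0 K0E => Ah Bh Ch L0 K0E.
move: (encodeA _ _ _ _ _ _ _ _) (_ *m polB K1) (polC K1 *m _) L1 => Ah' Bh' Ch' L1.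
have NE : decodeN M X Y \in unitmx.
  rewrite /decodeN unitmx_mul unitmx_tr unitmx_inv Mu andbT.
  exact: one_sub_XY_unit.
have [dA dB dC] := mx_derivable0_decode A B C Ah Bh Ch X' Y' Ah' Bh' Ch' NE.
exists (fun t => decode A B C M (mix t X X') (mix t Y Y') (mix t Ah Ah')
                  (mix t Bh Bh') (mix t Ch Ch')).
split; first by split=> //; rewrite !mix0.
move=> t /andP[t0 t1].
have t01 : 0 <= t <= 1 by rewrite t0 ltW.
have Lt := lifted_lmi_mix t01 L0 L1.
have [|||Pt [Ptp lmit]] := decode_certificate _ _ Mu _ Lt.
- by rewrite -mix_tr Xs Xs'.
- by rewrite -mix_tr Ys Ys'.
- rewrite (_ : liftP _ _ = mix t (liftP X Y) (liftP X' Y')).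
    exact: posdef_mix.
  by rewrite /liftP mix_block !mix_id.
by exists Pt, (mix t G0 G1).
Qed.

Theorem theorem4p2 (R : realType) (n m p : nat)
    (A : 'M[R]_n) (B : 'M[R]_(n, m)) (C : 'M[R]_(p, n))
    (Q W : 'M[R]_n) (Rw : 'M[R]_m) (V : 'M[R]_p)
    (n_gt0 : (0 < n)%N) (m_gt0 : (0 < m)%N) (p_gt0 : (0 < p)%N)
    (Q_psd : psd Q) (W_psd : psd W) (Rw_pd : posdef Rw) (V_pd : posdef V)
    (AB_ctrl : controllable A B) (AW_ctrl : controllable A (sqrtmx W))
    (CA_obs : observable C A) (QA_obs : observable (sqrtmx Q) A)
    (Ks : policy R n m p) :
  stabilizing A B C Ks ->
  stationary (JLQG A B C Q W Rw V) Ks ->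
  lqg_nondegenerate A B C Q W Rw V Ks ->
  forall K : policy R n m p, stabilizing A B C K ->
    JLQG A B C Q W Rw V Ks <= JLQG A B C Q W Rw V K.
Proof.
move=> stKs statKs [P [G [[Pp Nu _] lmi]]] K' stK'.
rewrite leNgt; apply/negP => JK'.
have J0 K0 : 0 <= JLQG A B C Q W Rw V K0 by exact: sqrtr_ge0.
set g0 := JLQG A B C Q W Rw V Ks in JK' lmi.
have [g1 /andP[J1 g10]] : exists g1, JLQG A B C Q W Rw V K' < g1 < g0.
  by exists ((JLQG A B C Q W Rw V K' + g0) / 2); rewrite !midf_lt.
have [P' [G' [Pp' lmi']]] := h2_lmi_complete stK' J1.
have [K [[K0 dA dB dC] certK]] := certified_path Pp Nu lmi Pp' lmi'.
have st_near : \forall t \near 0^'+, stable (Acl A B C (K t)).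
  have st0 : stable (Acl A B C (K 0)) by rewrite K0; exact: stKs.
  exact: cvg_within (stable_near (mx_derivable0_Acl dA dB dC) st0).
suff : 0 <= g1 - g0 by rewrite subr_ge0 leNgt g10.
have statK : stationary (JLQG A B C Q W Rw V) (K 0) by rewrite K0.
apply: (stationary_no_descent statK dA dB dC).
near=> t.
have t0 : 0 < t by near: t; exact: nbhs_right_gt.
have t1 : t < 1 by near: t; exact: nbhs_right_lt.
have g0_gt0 : 0 < g0 by apply: le_lt_trans (J0 K') JK'.
have g1_gt0 : 0 < g1 by apply: le_lt_trans (J0 K') J1.
have gt_gt0 : 0 < (1 - t) * g0 + t * g1 by rewrite addr_gt0 ?mulr_gt0 ?subr_gt0.
have [|Pt [Gt [Ptp lmit]]] := certK t; first by rewrite ltW.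
have -> : JLQG A B C Q W Rw V (K 0) + t * (g1 - g0) = (1 - t) * g0 + t * g1.
  by rewrite K0 mulrBr mulrBl mul1r -/g0 addrA addrAC.
have stKt : stable (Acl A B C (K t)) by near: t.
exact (h2_lmi_sound stKt gt_gt0 Ptp lmit).
Unshelve. all: by end_near. Qed.
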